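(* Let $\pi_0$ be an irreducible representation of $G(V_0)$, $\tau$ an irreducible representation of $\mathrm{GL}_{\mathbb E}(X)$, and $\pi\subset\mathrm{Ind}_P^{G(V)}(\tau\boxtimes\pi_0)$ an irreducible subrepresentation. Assume $\chi^{1+q}\ne1$. Then: (1) if the form on $V$ is nondegenerate, $j(\pi,\chi)=j(\tau\otimes\chi^{-c}_X,\chi^{1+q})\,j(\pi_0,\chi)$; (2) if the form on $V$ is zero, $j(\pi,\chi)=j(\tau,\chi)\,j(\pi_0,\chi)$.
   Context: Let $\mathbb F$ be a finite field of odd cardinality $q$, $\mathbb E/\mathbb F$ of degree $1$ or $2$ with Galois generator $x\mapsto\bar x$; $\mathcal C$ algebraically closed of characteristic not dividing $q$, with fixed $\sqrt q$. $(V,\langle\cdot,\cdot\rangle_V)$ is an $\epsilon$-sesquilinear space over $\mathbb E$ ($\mathbb E$-linear in the first variable, $\langle y,x\rangle=\epsilon_V\overline{\langle x,y\rangle}$, $\epsilon_V=1$ if $\mathbb E\ne\mathbb F$), nondegenerate or with zero form; $G(V)$ its isometry group, $\mathfrak g_V=\{A:\langle Ax,y\rangle+\langle x,Ay\rangle=0\}$ its Lie algebra ($=\mathrm{End}(V)$ for zero form); $G^0(V)=\{\det=1\}$ if $\mathbb E=\mathbb F,\epsilon_V=1$, nondegenerate, else $G^0(V)=G(V)$. For a character $\mu$ of $\mathbb E^\times$: $\mu^{-c}(x)=\mu(\bar x)^{-1}$, $\mu^{1+q}(x)=\mu(x\bar x)$. For an irreducible representation $\sigma$ of $G(W)$ (any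 such space $W$), $J(\sigma,\mu)=|\mathfrak g_W|^{-1/2}\sum_{g\in G^0(W),\,\det(\mathrm{id}+g)\ne0}\mu(\det(\mathrm{id}_W+g))\sigma(g)=j(\sigma,\mu)\,\mathrm{id}_\sigma$. The space $X$ is regarded as carrying the zero form (so $G(X)=\mathrm{GL}_{\mathbb E}(X)$), and $(\tau\otimes\chi_X^{-c})(a)=\chi(\overline{\det a})^{-1}\tau(a)$. Parabolic setup: if the form on $V$ is nondegenerate, $V=X\oplus V_0\oplus Y$ with $X,Y$ totally isotropic in duality and $V_0=(X\oplus Y)^\perp$ (with restricted form), and $P\subset G(V)$ is the stabilizer of $0\subset X\subset X\oplus V_0\subset V$ with Levi $\mathrm{GL}(X)\times G(V_0)$; if the form is zero, $V=X\oplus V_0$ and $P$ is the stabilizer of $X$ in $\mathrm{GL}(V)$ with Levi $\mathrm{GL}(X)\times\mathrm{GL}(V_0)$. *)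

(* Defs.v *)
From HB Require Import structures.
From mathcomp Require Import all_boot all_order all_algebra all_fingroup all_field.
From mathcomp Require Import mxrepresentation.
From mathcomp Require Import mxtens.

Set Implicit Arguments.
Unset Strict Implicit.
Unset Printing Implicit Defensive.

Import GRing.Theory.
Local Open Scope ring_scope.

(* Matrices act on column vectors, so composition = matrix product.   *)
Record GLt (E : finFieldType) (n : nat) := GLt_ {
  glmx : 'M[E]_n;
  glmx_unit : glmx \in unitmx }.
Arguments GLt_ {E n}.

HB.instance Definition _ (E : finFieldType) n := [isSub for @glmx E n].
HB.instance Definition _ (E : finFieldType) n := [Finite of GLt E n by <:].

Section GLgroup.
Variables (E : finFieldType) (n : nat).

Definition GLmul (A B : GLt E n) : GLt E n :=
  GLt_ (glmx A *m glmx B)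
       (ltac:(by rewrite unitmx_mul !glmx_unit)).
Definition GLone : GLt E n := GLt_ 1%:M (unitmx1 _ _).
Definition GLinv (A : GLt E n) : GLt E n :=
  GLt_ (invmx (glmx A)) (ltac:(by rewrite unitmx_inv glmx_unit)).

Lemma GLmulA : associative GLmul.
Proof. by move=> x y z; apply: val_inj; rewrite /= mulmxA. Qed.
Lemma GLmul1 : left_id GLone GLmul.
Proof. by move=> x; apply: val_inj; rewrite /= mul1mx. Qed.
Lemma GLmulV : left_inverse GLone GLinv GLmul.
Proof. by move=> x; apply: val_inj; rewrite /= mulVmx ?glmx_unit. Qed.

HB.instance Definition _ := Finite_isGroup.Build (GLt E n) GLmulA GLmul1 GLmulV.

Lemma glmxM (x y : GLt E n) : glmx (x * y)%g = glmx x *m glmx y.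
Proof. by []. Qed.
Lemma glmx1 : glmx (1%g : GLt E n) = 1%:M.
Proof. by []. Qed.

(* lift of a matrix into GL (defaults to 1 if the matrix is singular) *)
Definition toGL (A : 'M[E]_n) : GLt E n := insubd (1%g : GLt E n) A.

(* eps-sesquilinear forms <x,y> = x^T B bar(y) on column vectors E^n. *)
(* For B = 0 (zero form) these are GL(V) and End(V).                   *)
Variable bar : {rmorphism E -> E}.

Definition isom_set (B : 'M[E]_n) : {set GLt E n} :=
  [set g : GLt E n | (glmx g)^T *m B *m map_mx bar (glmx g) == B].

Lemma isom_group_set B : group_set (isom_set B).
Proof.
apply/group_setP; split.
  by rewrite inE glmx1 trmx1 map_mx1 mul1mx mulmx1.
move=> x y; rewrite !inE glmxM => /eqP Hx /eqP Hy.
rewrite map_mxM trmx_mul !mulmxA -(mulmxA _ _ B) -(mulmxA _ (_ *m B)).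
by rewrite Hx Hy.
Qed.

Canonical isom_group B := Group (isom_group_set B).

Definition lie_set (B : 'M[E]_n) : {set 'M[E]_n} :=
  [set A : 'M[E]_n | A^T *m B + B *m map_mx bar A == 0].

End GLgroup.

Definition qF (E : finFieldType) (bar : {rmorphism E -> E}) : nat :=
  #|[set x : E | bar x == x]|.

(* dim_F of the Lie algebra: |g_V| = q ^ dimF_lie *)
Definition dimF_lie (E : finFieldType) (bar : {rmorphism E -> E}) n
  (B : 'M[E]_n) : nat := trunc_log (qF bar) #|lie_set bar B|.

Definition G0_set (E : finFieldType) (bar : {rmorphism E -> E}) (eps : E) n
  (B : 'M[E]_n) : {set GLt E n} :=
  if [&& [forall x : E, bar x == x], eps == 1 & B \in unitmx]
  then [set g in isom_set bar B | \det (glmx g) == 1]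
  else isom_set bar B.

(* J(sigma, mu) = |g_W|^{-1/2} sum_{g in G^0, det(1+g) != 0}
                      mu(det(1+g)) sigma(g),
   with |g_W|^{-1/2} = sq^{-dim_F g_W} for the fixed square root sq of q *)
Definition Jmx (E : finFieldType) (C : fieldType) (bar : {rmorphism E -> E})
  (sq : C) (eps : E) n (B : 'M[E]_n) d (sigma : GLt E n -> 'M[C]_d)
  (mu : E -> C) : 'M[C]_d :=
  sq ^- (dimF_lie bar B) *:
    \sum_(g in G0_set bar eps B | \det (1%:M + glmx g) != 0)
       mu (\det (1%:M + glmx g)) *: sigma g.

(* a character of E^x (values at 0 are irrelevant) *)
Definition is_charE (E : finFieldType) (C : fieldType) (mu : E -> C) : Prop :=
  mu 1 = 1 /\ forall x y, x != 0 -> y != 0 -> mu (x * y) = mu x * mu y.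

(* Induced representation Ind_P^G(rho), as matrices acting on columns *)
(* of the space of functions f : G -> W with f(p g) = rho(p) f(g),     *)
(* G acting by right translation; coordinates: values at a fixed set  *)
(* of right coset representatives t_i. Block (i,j) of Ind(g) is       *)
(* rho(t_i g t_j^-1) if t_i g t_j^-1 in P, else 0.                     *)
Section Induced.
Variables (C : fieldType) (gT : finGroupType) (G P : {set gT}) (d : nat).
Variable rho : gT -> 'M[C]_d.

Definition coset_reps : seq gT := [seq repr K | K <- enum (rcosets P G)].
Definition tr (i : 'I_#|G : P|%g) : gT := nth 1%g coset_reps i.

Definition Ind_mx (g : gT) : 'M[C]_(\sum_(i < #|G : P|%g) d) :=
  @mxblock C _ _ (fun _ => d) (fun _ => d)
    (fun i j => let h := (tr i * g * (tr j)^-1)%g in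
                if h \in P then rho h else 0).
End Induced.

(* pi (as a column-vector representation) is isomorphic to a
   G-stable subspace of the representation Ind *)
Definition is_subrep (C : fieldType) (gT : finGroupType) (G : {set gT})
  dpi D (pi : gT -> 'M[C]_dpi) (Ind : gT -> 'M[C]_D) : Prop :=
  exists U : 'M[C]_(D, dpi),
    \rank U = dpi /\ forall g, g \in G -> Ind g *m U = U *m pi g.

(* Nondegenerate case: V = X (+) V0 (+) Y, dim X = dim Y = m, with a   *)
(* basis x_i of X and y_i of Y with <x_i,y_j> = delta_ij; the Gram     *)
(* matrix is [[0,0,1],[0,B0,0],[eps,0,0]].                               *)
Definition form_full (E : finFieldType) (eps : E) m n0 (B0 : 'M[E]_n0)
  : 'M[E]_(m + n0 + m) :=
  block_mx (block_mx 0 0 0 B0) (col_mx 1%:M 0)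
           (row_mx (eps%:M) 0) 0.

(* P = stabilizer of the flag 0 < X < X (+) V0 < V *)
Definition parab_nd (E : finFieldType) (bar : {rmorphism E -> E}) (eps : E)
  m n0 (B0 : 'M[E]_n0) : {set GLt E (m + n0 + m)} :=
  [set g in isom_set bar (form_full eps m B0) |
     (dlsubmx (glmx g) == 0) && (dlsubmx (ulsubmx (glmx g)) == 0)].

(* Levi components of g in P: action on X and on (X (+) V0)/X = V0 *)
Definition levi_X_nd (E : finFieldType) m n0 (g : GLt E (m + n0 + m))
  : GLt E m := toGL (ulsubmx (ulsubmx (glmx g))).
Definition levi_V0_nd (E : finFieldType) m n0 (g : GLt E (m + n0 + m))
  : GLt E n0 := toGL (drsubmx (ulsubmx (glmx g))).

(* Zero-form case: V = X (+) V0, P = stabilizer of X in GL(V) *)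
Definition parab_z (E : finFieldType) m n0 : {set GLt E (m + n0)} :=
  [set g : GLt E (m + n0) | dlsubmx (glmx g) == 0].
Definition levi_X_z (E : finFieldType) m n0 (g : GLt E (m + n0)) : GLt E m :=
  toGL (ulsubmx (glmx g)).
Definition levi_V0_z (E : finFieldType) m n0 (g : GLt E (m + n0)) : GLt E n0 :=
  toGL (drsubmx (glmx g)).

(* tau [x] pi0, inflated along P -> GL(X) x G(V0) *)
Definition boxtimes (C : comPzRingType) (gT hT kT : finGroupType)
  (fa : gT -> hT) (fb : gT -> kT) da db
  (tau : hT -> 'M[C]_da) (pi0 : kT -> 'M[C]_db) (g : gT) : 'M[C]_(da * db) :=
  tau (fa g) *t pi0 (fb g).

(* Main.v *)
Require Import Defs.
From HB Require Import structures.
From mathcomp Require Import all_boot all_order all_algebra all_fingroup all_field.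
From mathcomp Require Import cyclic mxrepresentation.
From mathcomp Require Import mxtens ring zify.
Import GRing.Theory.
Local Open Scope ring_scope.

Set Implicit Arguments.
Unset Strict Implicit.
Unset Printing Implicit Defensive.

(* Let phi(g) = chi(det(1 + g)) on G^0 (0 where det(1 + g) = 0): a class function
   on G(V). Evaluating sum_g phi(g) Ind(g) on coset representatives of P\G, the
   block at (t_i, t_j) is sum_{p in P} phi(p y) rho(p) with y = t_j t_i^-1.
   For y outside P it vanishes because sum_{n in N} phi(n y) = 0, N being the
   unipotent radical: as y X <> X, the space X is not contained in (1 + y) X, so
   there are eta orthogonal to (1 + y) X and xi in X with <xi, eta> = u - 1.
   With L = 1 + xi <., eta> and R = 1 - eps (y^-1 eta) <., xi>, the map
   n |-> L (n + y) R - y is a bijection of N and multiplies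
   det(1 + n^-1 y) = det(n + y) by det L det R = u (bar u); choose u with
   chi(u (bar u)) <> 1. (For the zero form take R = 1.) For y = 1, det(1 + p)
   depends only on the Levi part of p, so the block is |N| times the product of
   the two smaller sums, and |g_V| = |gl_X| |g_V0| |N|^2 matches the
   normalizations. *)

(** * Vanishing of rescaled sums, and sums of Kronecker products *)

(** An injective self-map of the finite set [A] is a bijection, so reindexing by [f] multiplies the
    sum by [c]; as [c != 1], the sum is zero. *)
Lemma sum_eq0_scaled (C : fieldType) (T : finType) (A : {set T}) (f : T -> T)
    (psi : T -> C) (c : C) :
  c != 1 -> {in A, forall x, f x \in A} -> {in A &, injective f} ->
  {in A, forall x, psi (f x) = c * psi x} ->
  \sum_(x in A) psi x = 0.
Proof.
move=> c_neq1 fA f_inj psi_f.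
have imfA : [set f x | x in A] = A.
  apply/eqP; rewrite eqEcard card_in_imset // leqnn andbT.
  by apply/subsetP => _ /imsetP[x Ax ->]; apply: fA.
have sumE : \sum_(x in A) psi x = c * \sum_(x in A) psi x.
  by rewrite -[in LHS]imfA big_imset //= mulr_sumr; apply: eq_bigr.
apply/eqP; have /eqP : (1 - c) * \sum_(x in A) psi x = 0.
  by rewrite mulrBl mul1r -sumE subrr.
by rewrite mulf_eq0 subr_eq0 eq_sym (negPf c_neq1).
Qed.

Lemma tensmx_suml (R : comPzRingType) (I : finType) (A : {pred I}) m n p q
    (F : I -> 'M[R]_(m, n)) (M : 'M[R]_(p, q)) :
  \sum_(i in A) (F i *t M) = (\sum_(i in A) F i) *t M.
Proof.
by apply/matrixP=> i j; rewrite summxE mxE summxE mulr_suml;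
  apply: eq_bigr => k _; rewrite mxE.
Qed.

Lemma tensmx_sumr (R : comPzRingType) (I : finType) (A : {pred I}) m n p q
    (F : I -> 'M[R]_(m, n)) (M : 'M[R]_(p, q)) :
  \sum_(i in A) (M *t F i) = M *t (\sum_(i in A) F i).
Proof.
by apply/matrixP=> i j; rewrite summxE mxE summxE mulr_sumr;
  apply: eq_bigr => k _; rewrite mxE.
Qed.

Lemma tensmx_scale (R : comPzRingType) m n p q (a b : R)
    (M : 'M[R]_(m, n)) (N : 'M[R]_(p, q)) :
  (a *: M) *t (b *: N) = (a * b) *: (M *t N).
Proof. by apply/matrixP=> i j; rewrite !mxE mulrACA. Qed.

Lemma tensmx_scalar (R : comPzRingType) m n (a b : R) :
  (a%:M : 'M_m) *t (b%:M : 'M_n) = (a * b)%:M.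
Proof.
apply/matrixP => i j.
case: (mxtens_indexP i) (mxtens_indexP j) => i1 i2 [j1 j2].
rewrite tensmxE !mxE (can_eq (@mxtens_indexK m n)) xpair_eqE.
by do 2!case: eqP => _; rewrite ?mulr0n ?mul0r ?mulr0 ?mulr1n.
Qed.

(** * Class functions acting on a parabolically induced representation *)

Section ParabolicInduction.
Variables (C : fieldType) (gT hT kT : finGroupType).
Variables (G P : {group gT}) (H : {group hT}) (K : {group kT}).
Variables (fa : gT -> hT) (fb : gT -> kT) (lev : hT -> kT -> gT).
Hypothesis sPG : P \subset G.
Hypothesis fa_in : {in P, forall p, fa p \in H}.
Hypothesis fb_in : {in P, forall p, fb p \in K}.
Hypothesis faM : {in P &, {morph fa : x y / (x * y)%g}}.
Hypothesis fbM : {in P &, {morph fb : x y / (x * y)%g}}.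
Hypothesis lev_in : {in H & K, forall a h, lev a h \in P}.
Hypothesis fa_lev : {in H & K, forall a h, fa (lev a h) = a}.
Hypothesis fb_lev : {in H & K, forall a h, fb (lev a h) = h}.

(** Taken as the kernel of the projection [(fa, fb)] of [P] onto its Levi quotient, so that one
    argument serves both parabolics. *)
Definition unip_radical := [set p in P | (fa p == 1%g) && (fb p == 1%g)].

Let fa1 : fa 1%g = 1%g.
Proof. by apply: (mulgI (fa 1%g)); rewrite -faM // !mulg1. Qed.
Let fb1 : fb 1%g = 1%g.
Proof. by apply: (mulgI (fb 1%g)); rewrite -fbM // !mulg1. Qed.
Let faV p : p \in P -> fa p^-1%g = (fa p)^-1%g.
Proof.
by move=> Pp; apply: (mulgI (fa p)); rewrite -faM ?groupV // !mulgV fa1.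
Qed.
Let fbV p : p \in P -> fb p^-1%g = (fb p)^-1%g.
Proof.
by move=> Pp; apply: (mulgI (fb p)); rewrite -fbM ?groupV // !mulgV fb1.
Qed.

Lemma unip_radicalV n : n \in unip_radical -> n^-1%g \in unip_radical.
Proof.
rewrite !inE => /and3P[Pn /eqP an /eqP bn].
by rewrite groupV Pn faV // fbV // an bn !invg1 !eqxx.
Qed.

(** The fibre of [(fa, fb)] over [(a, h)] is the coset of [unip_radical] through [lev a h]. *)
Lemma sum_parabolic (V : nmodType) (F : gT -> V) :
  \sum_(p in P) F p =
  \sum_(a in H) \sum_(h in K) \sum_(n in unip_radical) F (n * lev a h)%g.
Proof.
rewrite (partition_big fa (mem H)) //=; apply: eq_bigr => a Ha.
rewrite (partition_big fb (mem K)) /=; last by move=> p /andP[Pp _]; apply: fb_in.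
apply: eq_bigr => h Kh; have Pl := lev_in Ha Kh.
rewrite (reindex_inj (mulIg (lev a h))) /=; apply: eq_bigl => n.
rewrite !inE groupMr //; case: (boolP (n \in P)) => //= Pn.
rewrite faM // fbM // fa_lev // fb_lev //.
by rewrite (eq_mulgV1 _ a) (eq_mulgV1 _ h) !mulgK .
Qed.

Variables (da db : nat) (tau : hT -> 'M[C]_da) (pi0 : kT -> 'M[C]_db).
Let rho := boxtimes fa fb tau pi0.

Variable phi : gT -> C.
Hypothesis phiJ : {in G &, forall g x, phi (x^-1 * g * x)%g = phi g}.
Hypothesis phi_cusp : forall y, y \in G -> y \notin P ->
  \sum_(n in unip_radical) phi (n * y)%g = 0.

(** Since [rho] factors through [(fa, fb)], it is constant in the innermost sum over the unipotent
    radical; what remains there is the cuspidal sum at [lev a h * y], again outside [P]. *)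
Lemma sum_off_parabolic y : y \in G -> y \notin P ->
  \sum_(p in P) phi (p * y)%g *: rho p = 0.
Proof.
move=> Gy nPy; rewrite sum_parabolic big1 // => a Ha; rewrite big1 // => h Kh.
have Pl := lev_in Ha Kh.
rewrite (eq_bigr (fun n => phi (n * (lev a h * y))%g *: (tau a *t pi0 h))).
  rewrite -scaler_suml phi_cusp ?scale0r ?groupMl //.
  exact: (subsetP sPG).
move=> n; rewrite inE => /and3P[Pn /eqP an /eqP bn].
by rewrite mulgA /rho /boxtimes faM // fbM // an bn !mul1g fa_lev // fb_lev.
Qed.

Let t_ (i : 'I_#|G : P|%g) : gT := tr i.

Lemma tr_rcoset i : rcoset P (t_ i) \in rcosets P G.
Proof.
rewrite /t_ /tr /coset_reps; have lt_i : (i < size (enum (rcosets P G)))%N.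
  by rewrite -cardE.
rewrite (nth_map set0) //.
have : nth set0 (enum (rcosets P G)) i \in rcosets P G.
  by rewrite -mem_enum mem_nth.
case/rcosetsP => x Gx ->; rewrite rcosetE rcoset_repr.
by apply/rcosetsP; exists x.
Qed.

Lemma tr_in i : t_ i \in G.
Proof.
have /rcosetsP[x Gx] := tr_rcoset i; rewrite rcosetE => eqPx.
have : t_ i \in (P :* x)%g by rewrite -eqPx rcoset_refl.
by case/rcosetP => p Pp ->; rewrite groupM // (subsetP sPG).
Qed.

Lemma tr_inj i j : (t_ j * (t_ i)^-1)%g \in P -> i = j.
Proof.
move=> Pij; have sz : size (enum (rcosets P G)) = #|G : P|%g by rewrite -cardE.
have nthE k : nth set0 (enum (rcosets P G)) (k : 'I_#|G : P|%g) = (P :* t_ k)%g.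
  rewrite /t_ /tr /coset_reps (nth_map set0) ?sz //.
  have : nth set0 (enum (rcosets P G)) k \in rcosets P G.
    by rewrite -mem_enum mem_nth ?sz.
  by case/rcosetsP => x Gx ->; rewrite rcoset_repr.
apply/val_inj/eqP.
rewrite -(nth_uniq set0 _ _ (enum_uniq (rcosets P G))) ?sz //= !nthE.
by rewrite eq_sym; apply/eqP/rcoset_eqP; rewrite mem_rcoset.
Qed.

Lemma sum_Ind_scalar (c : C) :
  \sum_(p in P) phi p *: rho p = c%:M ->
  \sum_(g in G) phi g *: Ind_mx G P rho g = c%:M.
Proof.
move=> sumP.
rewrite -[LHS]submxblockK -[RHS]submxblockK; apply: eq_mxblock => i j.
rewrite submxblock_sum.
have -> : submxblock (c%:M : 'M[C]_(\sum_(i < #|G : P|%g) (da * db))) i j =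
          if i == j then c%:M else 0.
  apply/matrixP => k l; rewrite !mxE -val_eqE /= tagnat.eq_Rank.
  by case: eqP => _; rewrite !mxE // val_eqE.
have [Gi Gj] := (tr_in i, tr_in j).
(* Substitute [g = t_i^-1 p t_j] in block [(i, j)]; conjugation by [t_i], which leaves [phi]
   unchanged, then brings [t_j t_i^-1] to the right of [p]. *)
transitivity (\sum_(p in P) phi (p * (t_ j * (t_ i)^-1))%g *: rho p).
  rewrite (eq_bigr (fun g => if (t_ i * g * (t_ j)^-1)%g \in P
      then phi g *: rho (t_ i * g * (t_ j)^-1)%g else 0)); last first.
    move=> g Gg; apply/matrixP => k l.
    have := mxblockK (fun i j => let h := (t_ i * g * (t_ j)^-1)%g in
                if h \in P then rho h else 0) i j.
    move/matrixP/(_ k l); rewrite /Ind_mx !mxE /= => ->.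
    by case: ifP => _; rewrite !mxE ?mulr0.
  rewrite -big_mkcondr /=.
  rewrite (reindex_inj (mulIg (t_ j))) /= (reindex_inj (mulgI (t_ i)^-1%g)) /=.
  apply: eq_big => p; rewrite !mulgA !mulgV !mul1g !mulgK.
    case: (boolP (p \in P)) => Pp; rewrite ?andbF // andbT.
    by rewrite !groupM ?groupV // (subsetP sPG).
  case/andP => _ Pp; congr (_ *: _).
  have Gp : (p * (t_ j * (t_ i)^-1))%g \in G.
    by rewrite !groupM ?groupV // (subsetP sPG).
  by have := phiJ Gp Gi; rewrite !mulgA mulgKV.
case: (eqVneq i j) => [<- | neq_ij].
  by rewrite -sumP; apply: eq_bigr => p _; rewrite mulgV mulg1.
apply: sum_off_parabolic; first by rewrite groupM ?groupV.
by apply: contra neq_ij => /tr_inj->.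
Qed.

Variables (phiX : hT -> C) (phi0 : kT -> C).
Hypothesis phi_levi : {in unip_radical, forall n, {in H & K, forall a h,
  phi (n * lev a h)%g = phiX a * phi0 h}}.

Lemma sum_subrep_scalar (x y : C) dpi (pi : gT -> 'M[C]_dpi) :
  \sum_(a in H) phiX a *: tau a = x%:M ->
  \sum_(h in K) phi0 h *: pi0 h = y%:M ->
  is_subrep G pi (Ind_mx G P rho) ->
  \sum_(g in G) phi g *: pi g = (#|unip_radical|%:R * (x * y))%:M.
Proof.
move=> sumX sum0 [U [rankU IndU]].
(* On each fibre of the Levi projection both [phi] and [rho] are constant, which produces the factor
   [#|unip_radical|]; the remaining double sum splits as a Kronecker product. *)
have sumP : \sum_(p in P) phi p *: rho p = (#|unip_radical|%:R * (x * y))%:M.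
  rewrite sum_parabolic -scale_scalar_mx -tensmx_scalar -sumX -tensmx_suml.
  rewrite scaler_sumr; apply: eq_bigr => a Ha.
  rewrite -sum0 -tensmx_sumr scaler_sumr; apply: eq_bigr => h Kh.
  rewrite tensmx_scale scaler_nat -sumr_const; apply: eq_bigr => n Nn.
  rewrite phi_levi //; congr (_ *: _).
  move: Nn; rewrite inE => /and3P[Pn /eqP an /eqP bn].
  have Pl := lev_in Ha Kh.
  by rewrite /rho /boxtimes faM // fbM // an bn !mul1g fa_lev // fb_lev.
(* [U] has full column rank, hence cancels on the left, and the scalar found on the induced
   representation descends to [pi]. *)
have U_inj : injective (mulmx U : 'M[C]_dpi -> _).
  move=> A B; rewrite -[A]mul1mx -[B]mul1mx.
  have fU : row_free U^T by rewrite /row_free mxrank_tr rankU.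
  by move/(congr1 trmx); rewrite !mul1mx !trmx_mul => /(row_free_inj fU)/trmx_inj.
apply: U_inj; rewrite mul_mx_scalar mulmx_sumr.
rewrite (eq_bigr (fun g => (phi g *: Ind_mx G P rho g) *m U)); last first.
  by move=> g Gg; rewrite -scalemxAl -scalemxAr IndU.
by rewrite -mulmx_suml (sum_Ind_scalar sumP) mul_scalar_mx.
Qed.
End ParabolicInduction.

(** * Rank-one perturbations and separating functionals *)

(** The bordered matrix with blocks [1], [-w], [x], [1] has two triangular factorizations, one for
    each Schur complement; compare their determinants. *)
Lemma det_add_col_row (R : comPzRingType) n (x : 'cV[R]_n) (w : 'rV[R]_n) :
  \det (1%:M + x *m w) = 1 + (w *m x) 0 0.
Proof.
have e1 : block_mx (1%:M : 'M_1) (- w) x 1%:M =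
    block_mx 1%:M 0 x 1%:M *m block_mx 1%:M (- w) 0 (1%:M + x *m w).
  rewrite mulmx_block ?mul1mx ?mul0mx ?mulmx1 ?mulmx0 ?addr0.
  by rewrite mulmxN addrCA addNr addr0.
have e2 : block_mx (1%:M : 'M_1) (- w) x 1%:M =
    block_mx 1%:M (- w) 0 1%:M *m block_mx (1%:M + w *m x) 0 x 1%:M.
  rewrite mulmx_block ?mul1mx ?mul0mx ?mulmx1 ?mulmx0 ?add0r.
  by rewrite mulNmx addrK.
have := congr1 determinant e1; rewrite e2 !det_mulmx !det_ublock !det_lblock.
by rewrite !det1 !mul1r !mulr1 det_mx11 !mxE => ->.
Qed.

(** Let X be the span of the columns of [J]. If X were contained in [(1 + g) X], comparing ranks
    would give equality, so [g] would preserve X. Otherwise a column of the cokernel kills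
    [(1 + g) X] but not X. *)
Lemma exists_separating_functional (F : fieldType) n m (g : 'M[F]_n)
    (J : 'M[F]_(n, m)) :
  \rank J = m -> (forall Q, g *m J <> J *m Q) ->
  exists2 w : 'rV[F]_n, w *m ((1%:M + g) *m J) = 0 & w *m J != 0.
Proof.
move=> rankJ ninvJ; set M := (1%:M + g) *m J.
case: (boolP (J^T <= M^T)%MS) => [sJM | ].
  have : (M^T <= J^T)%MS.
    rewrite -(geq_leqif (mxrank_leqif_sup sJM)) !mxrank_tr rankJ.
    by rewrite (leq_trans (mxrankM_maxr _ _)) ?rankJ.
  case/submxP => Q /(congr1 trmx); rewrite trmxK trmx_mul trmxK /M mulmxDl mul1mx.
  move=> e; case: (ninvJ (Q^T - 1%:M)); rewrite mulmxBr mulmx1 -e.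
  by rewrite addrC addKr.
rewrite submxE => /eqP nz.
have [j nzj] : exists j, J^T *m col j (cokermx M^T) != 0.
  apply/existsP; apply: contra_notT nz => /existsPn z.
  apply/matrixP => i j; have /negPn/eqP/matrixP/(_ i 0) := z j.
  by rewrite colE mulmxA -colE !mxE.
exists (col j (cokermx M^T))^T.
  by apply: trmx_inj; rewrite trmx_mul trmxK colE mulmxA mulmx_coker mul0mx trmx0.
by rewrite -(inj_eq trmx_inj) trmx_mul trmxK trmx0.
Qed.

(** * Cardinalities of spaces over the fixed field of [bar] *)

Section FixedField.
Variables (E : finFieldType) (bar : {rmorphism E -> E}).

Lemma qF_gt1 : (1 < qF bar)%N.
Proof.
rewrite /qF; have sub : [set 0; 1] \subset [set x : E | bar x == x].
  by apply/subsetP => x; rewrite !inE => /orP[]/eqP->; rewrite ?rmorph0 ?rmorph1.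
by move/subset_leq_card: sub; rewrite cards2 eq_sym oner_neq0.
Qed.

(** A subspace [T] grows from zero until it fills [S]: adjoining a vector [v] outside [T] multiplies
    its cardinality by [qF bar]. *)
Lemma card_fixed_submodule m n (S : {set 'M[E]_(m, n)}) :
  0 \in S -> {in S &, forall x y, x + y \in S} ->
  (forall c x, bar c = c -> x \in S -> c *: x \in S) ->
  exists k, #|S| = (qF bar ^ k)%N.
Proof.
move=> S0 SD SZ; pose F := [set x : E | bar x == x].
have grow r : forall T : {set 'M[E]_(m, n)}, (#|S :\: T| <= r)%N ->
    T \subset S -> 0 \in T -> {in T &, forall x y, x + y \in T} ->
    (forall c x, bar c = c -> x \in T -> c *: x \in T) ->
    (exists k, #|T| = (qF bar ^ k)%N) -> exists k, #|S| = (qF bar ^ k)%N.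
  elim: r => [|r IHr] T leT sTS T0 TD TZ [k cardT].
    exists k; rewrite -cardT; congr #|pred_of_set _|; apply/eqP.
    by rewrite eqEsubset sTS andbT -setD_eq0 -cards_eq0 -leqn0.
  have [sST|] := boolP (S \subset T).
    by exists k; rewrite -cardT; congr #|pred_of_set _|; apply/eqP; rewrite eqEsubset sTS sST.
  case/subsetPn => v Sv nTv.
  pose f (ct : E * 'M[E]_(m, n)) := ct.1 *: v + ct.2.
  have finj : {in setX F T &, injective f}.
    move=> [c t] [c' t']; rewrite !inE /= => /andP[/eqP Fc Tt] /andP[/eqP Fc' Tt'].
    (* Two distinct coefficients would exhibit [v] as a scalar multiple, over the fixed field, of a
       difference of elements of [T]. *)
    rewrite /f /= => e; have ecc : c = c'.
      apply/eqP; apply: contraNT nTv => nec.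
      have -> : v = (c - c')^-1 *: (t' - t).
        have -> : t' - t = (c - c') *: v.
          by apply: (addrI (c' *: v)); rewrite scalerBl addrA -e addrK addrC subrK.
        by rewrite scalerA mulVf ?scale1r // subr_eq0.
      apply: (TZ); first by rewrite fmorphV rmorphB Fc Fc'.
      by rewrite TD // -scaleN1r TZ // rmorphN rmorph1.
    by move: e; rewrite ecc => /addrI->.
  pose T' := [set f x | x in setX F T].
  have T'P x : reflect (exists c t, [/\ bar c = c, t \in T & x = c *: v + t]) (x \in T').
    apply: (iffP imsetP) => [[[c t]]|[c [t [Fc Tt ->]]]].
      by rewrite !inE /= => /andP[/eqP Fc Tt] ->; exists c, t.
    by exists (c, t); rewrite // !inE /= Tt Fc eqxx.
  have sTT' : T \subset T'.
    apply/subsetP => t Tt; apply/T'P; exists 0, t.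
    by rewrite rmorph0 scale0r add0r.
  have T'v : v \in T'.
    by apply/T'P; exists 1, 0; rewrite rmorph1 scale1r addr0.
  apply: (IHr T').
  - rewrite -ltnS; apply: leq_trans leT; apply: proper_card.
    rewrite properE setDS //=; apply/subsetPn; exists v; rewrite !inE ?nTv //.
    by rewrite T'v.
  - apply/subsetP => _ /T'P[c [t [Fc Tt ->]]].
    by rewrite SD ?SZ // (subsetP sTS).
  - exact: (subsetP sTT').
  - move=> _ _ /T'P[c [t [Fc Tt ->]]] /T'P[d [s [Fd Ts ->]]].
    apply/T'P; exists (c + d), (t + s).
    by rewrite rmorphD Fc Fd TD // scalerDl addrACA.
  - move=> a _ Fa /T'P[c [t [Fc Tt ->]]].
    apply/T'P; exists (a * c), (a *: t).
    by rewrite rmorphM Fa Fc TZ // scalerDr scalerA.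
  exists k.+1; rewrite card_in_imset // cardsX cardT expnS //.
apply: (grow _ [set 0] (leqnn _)).
- by rewrite sub1set.
- by rewrite inE.
- by move=> x y; rewrite !inE => /eqP-> /eqP->; rewrite addr0.
- by move=> c x _; rewrite !inE => /eqP->; rewrite scaler0.
by exists 0%N; rewrite cards1.
Qed.

(** The cardinality of [E] is a power of the odd number [qF bar]; if [2 = 0], the additive order 2
    of [1] would divide it. *)
Lemma two_neq0 : odd (qF bar) -> 2%:R != 0 :> E.
Proof.
move=> q_odd; have [k cardE] := @card_fixed_submodule 1 1 [set: 'M[E]_(1, 1)]
  (in_setT _) (fun _ _ _ _ => in_setT _) (fun _ _ _ _ => in_setT _).
have oddE : odd #|E|.
  by move: cardE; rewrite cardsT card_mx expn1 => ->; rewrite oddX q_odd orbT.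
apply: contraTneq oddE => two0.
have ord1 : #[(1%R : E)]%g = 2.
  by apply: nt_prime_order => //; exact: oner_neq0.
have := order_dvdG (in_setT (1 : E)); rewrite ord1 cardsT dvdn2.
by case: odd.
Qed.

End FixedField.

(** * The weight in J as a class function, and its cuspidality *)

Section JKernel.
Variables (E : finFieldType) (C : fieldType) (bar : {rmorphism E -> E}).
Variables (eps : E) (n : nat) (B : 'M[E]_n) (mu : E -> C).

(** This is the [phi] of the overview, extended by zero so that J becomes a sum over the full
    isometry group, on which the induced representation lives. *)
Definition jkernel (g : GLt E n) : C :=
  if (g \in G0_set bar eps B) && (\det (1%:M + glmx g) != 0)
  then mu (\det (1%:M + glmx g)) else 0.

Lemma in_G0_set g : (g \in G0_set bar eps B) = (g \in isom_set bar B) &&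
  ([&& [forall x : E, bar x == x], eps == 1 & B \in unitmx] ==>
   (\det (glmx g) == 1)).
Proof.
by rewrite /G0_set; case: ifP => _; rewrite ?andbT // inE.
Qed.

Lemma Jmx_jkernel sq d (sigma : GLt E n -> 'M[C]_d) :
  Jmx bar sq eps B sigma mu =
  sq ^- dimF_lie bar B *: \sum_(g in isom_set bar B) jkernel g *: sigma g.
Proof.
congr (_ *: _); rewrite [RHS]big_mkcond /= big_mkcond /=.
apply: eq_bigr => g _; rewrite /jkernel in_G0_set.
by case: (g \in _) => //=; case: ifP; rewrite ?scale0r.
Qed.

Lemma glmxV_l (x : GLt E n) : glmx x^-1%g *m glmx x = 1%:M.
Proof. by rewrite -glmxM mulVg. Qed.

Lemma glmxV_r (x : GLt E n) : glmx x *m glmx x^-1%g = 1%:M.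
Proof. by rewrite -glmxM mulgV. Qed.

Lemma jkernelJ : {in isom_group bar B &, forall g x,
  jkernel (x^-1 * g * x)%g = jkernel g}.
Proof.
move=> g x Gg Gx; rewrite /jkernel !in_G0_set !glmxM !det_mulmx.
have -> : 1%:M + glmx x^-1%g *m glmx g *m glmx x =
    glmx x^-1%g *m (1%:M + glmx g) *m glmx x.
  by rewrite mulmxDr mulmx1 mulmxDl glmxV_l.
have conjd d : \det (glmx x^-1%g) * d * \det (glmx x) = d.
  by rewrite mulrAC -det_mulmx glmxV_l det1 mul1r.
rewrite !det_mulmx !conjd.
by rewrite (groupM (groupM (groupVr Gx) Gg) Gx : _ \in isom_set _ _) Gg.
Qed.

(* The bijection [n |-> L (n + y) R - y] of [N] scales [det (1 + n^-1 y) = det (n + y)]. *)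
Lemma jkernel_cusp (N : {set GLt E n}) (L R : 'M[E]_n) (y : GLt E n) :
  is_charE mu -> L \in unitmx -> R \in unitmx -> mu (\det L * \det R) != 1 ->
  N \subset isom_set bar B -> {in N, forall x, x^-1%g \in N} ->
  {in N, forall x, \det (glmx x) = 1} -> y \in isom_set bar B ->
  (forall x, x \in N ->
    exists2 x', x' \in N & glmx x' = L *m (glmx x + glmx y) *m R - glmx y) ->
  \sum_(x in N) jkernel (x * y)%g = 0.
Proof.
move=> [mu1 muM] uL uR mu_neq1 sNG NV detN Gy Nstep.
(* After inversion in [N] the relevant determinant is that of [n + y], on which [L] and [R] act by
   multiplication. *)
rewrite (reindex_inj (@invg_inj (GLt E n))) /=.
have NVE x : (x^-1%g \in N) = (x \in N).
  by apply/idP/idP => /NV //; rewrite invgK.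
rewrite (eq_bigl _ _ NVE).
have detD x : x \in N ->
    \det (1%:M + glmx (x^-1 * y)%g) = \det (glmx x + glmx y).
  move=> Nx; have := congr1 determinant (glmxV_l x).
  rewrite det_mulmx (detN x Nx) mulr1 det1 glmxM => dV.
  have -> : 1%:M + glmx x^-1%g *m glmx y = glmx x^-1%g *m (glmx x + glmx y).
    by rewrite mulmxDr glmxV_l.
  by rewrite det_mulmx dV mul1r.
(* Elements of [N] are isometries of determinant 1, so membership of [x^-1 * y] in G^0 depends on
   [y] alone. *)
have G0E x : x \in N -> ((x^-1 * y)%g \in G0_set bar eps B) =
    (y \in G0_set bar eps B).
  move=> Nx; have Gx := subsetP sNG _ (NV _ Nx).
  rewrite !in_G0_set glmxM det_mulmx (detN _ (NV _ Nx)) mul1r.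
  by rewrite (groupM Gx Gy : _ \in isom_set _ _) Gy.
pose f (x : GLt E n) := toGL (L *m (glmx x + glmx y) *m R - glmx y).
(* By [Nstep] the matrix is that of an element of [N], so the default value of [toGL] never arises
   on [N]. *)
have fE x : x \in N -> f x \in N /\ glmx (f x) = L *m (glmx x + glmx y) *m R - glmx y.
  case/Nstep => x' Nx' e; suff -> : f x = x' by [].
  by rewrite /f -e; apply: val_inj; rewrite val_insubd glmx_unit.
apply: (sum_eq0_scaled (f := f) mu_neq1).
- by move=> x /fE[].
- move=> x1 x2 /fE[_ e1] /fE[_ e2] /(congr1 (@glmx E n)); rewrite e1 e2.
  move/addIr; rewrite -!mulmxA => /(can_inj (mulKmx uL)).
  by move/(can_inj (mulmxK uR))/addIr/val_inj.
move=> x Nx; have [Nfx e] := fE x Nx.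
rewrite /jkernel !detD // !G0E //.
have -> : \det (glmx (f x) + glmx y) =
    \det L * \det R * \det (glmx x + glmx y).
  by rewrite e subrK !det_mulmx mulrAC.
have uLR : \det L * \det R != 0.
  by rewrite mulf_neq0 // -unitfE -unitmxE.
case: (y \in _); rewrite /= ?mulr0 // mulf_eq0 (negPf uLR) /=.
by case: eqP => [_|/eqP nz]; rewrite ?mulr0 //= muM.
Qed.

End JKernel.

(** * Characters, block triangular matrices and functionals with a prescribed value *)

Lemma is_charE_neq0 (E : finFieldType) (C : fieldType) (mu : E -> C) x :
  is_charE mu -> x != 0 -> mu x != 0.
Proof.
move=> [mu1 muM] nz; apply: contra_eq_neq mu1 => /eqP mux.
by rewrite -(mulfV nz) muM ?invr_eq0 // (eqP mux) mul0r eq_sym oner_neq0.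
Qed.

Lemma isom_set0 (E : finFieldType) (bar : {rmorphism E -> E}) n :
  isom_set bar (0 : 'M_n) = setT.
Proof. by apply/setP => g; rewrite !inE mulmx0 mul0mx eqxx. Qed.

Lemma glmx_toGL (E : finFieldType) n (A : 'M[E]_n) :
  A \in unitmx -> glmx (toGL A) = A.
Proof. by move=> uA; rewrite val_insubd uA. Qed.

Lemma glmx_block_unit (E : finFieldType) m n (g : GLt E (m + n)) :
  dlsubmx (glmx g) = 0 ->
  (ulsubmx (glmx g) \in unitmx) && (drsubmx (glmx g) \in unitmx).
Proof.
move=> dl0; have := glmx_unit g; rewrite -[glmx g]submxK dl0.
by rewrite !unitmxE det_ublock unitrM block_mxKul block_mxKdr.
Qed.

Lemma mulmx_ublock (R : pzRingType) m n (A B : 'M[R]_(m + n)) :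
  dlsubmx A = 0 -> dlsubmx B = 0 ->
  [/\ dlsubmx (A *m B) = 0, ulsubmx (A *m B) = ulsubmx A *m ulsubmx B &
      drsubmx (A *m B) = drsubmx A *m drsubmx B].
Proof.
move=> A0 B0; rewrite -[A]submxK -[B]submxK A0 B0 mulmx_block.
rewrite !block_mxKdl !block_mxKul !block_mxKdr.
by rewrite !mul0mx !mulmx0 !addr0 add0r.
Qed.

(** Rescale a basis vector of X on which [w] does not vanish. The value [c] will be [u - 1], which
    gives [1 + xi w] the determinant [u]. *)
Lemma exists_functional_value (F : fieldType) n m (g : 'M[F]_n)
    (J : 'M[F]_(n, m)) (c : F) :
  \rank J = m -> (forall Q, g *m J <> J *m Q) ->
  exists w : 'rV[F]_n, exists x : 'cV[F]_m,
    w *m ((1%:M + g) *m J) = 0 /\ w *m (J *m x) = c%:M.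
Proof.
move=> rankJ ninvJ; have [w w0 nzw] := exists_separating_functional rankJ ninvJ.
have /rV0Pn[k nzk] := nzw.
exists w, ((c / (w *m J) 0 k) *: delta_mx k 0); split=> //.
rewrite mulmxA -scalemxAr -colE; apply/matrixP => i j; rewrite !ord1 mxE [X in _ * X]mxE.
by rewrite mulfVK // mxE eqxx.
Qed.

(** The zero matrix is a unit only in dimension 0, and there every determinant is 1. *)
Lemma in_G0_set0 (E : finFieldType) (bar : {rmorphism E -> E}) n (g : GLt E n) :
  g \in G0_set bar 1 (0 : 'M_n).
Proof.
rewrite in_G0_set isom_set0 inE /=; apply/implyP => /and3P[_ _].
by case: n g => [|n] g; rewrite ?det_mx00 // unitmxE det0 unitr0.
Qed.

(** * Matching the powers of the square root of [q] *)

Section Normalization.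
Variables (E : finFieldType) (C : fieldType) (bar : {rmorphism E -> E}) (sq : C).
Hypothesis q_unit : (qF bar)%:R != 0 :> C.
Hypothesis sq_def : sq ^+ 2 = (qF bar)%:R.

Lemma sq_neq0 : sq != 0.
Proof. by apply: contraNneq q_unit => sq0; rewrite -sq_def sq0 expr0n. Qed.

(** The truncated logarithm in [dimF_lie] is exact, since the Lie algebra is a vector space over the
    fixed field. *)
Lemma card_lie_set n (B : 'M[E]_n) :
  #|lie_set bar B| = (qF bar ^ dimF_lie bar B)%N.
Proof.
have [||| k cardk] := @card_fixed_submodule E bar n n (lie_set bar B).
- by rewrite inE trmx0 map_mx0 mul0mx mulmx0 addr0.
- move=> x y; rewrite !inE => /eqP ex /eqP ey.
  rewrite linearD /= map_mxD mulmxDl mulmxDr addrACA ex ey addr0 //.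
- move=> c x ec; rewrite !inE => /eqP ex.
  by rewrite linearZ /= map_mxZ ec -scalemxAl -scalemxAr -scalerDr ex scaler0.
by rewrite /dimF_lie cardk trunc_expnK ?qF_gt1.
Qed.

Lemma Jmx_sum eps n (B : 'M[E]_n) (mu : E -> C) d (sigma : GLt E n -> 'M[C]_d) a :
  Jmx bar sq eps B sigma mu = a%:M ->
  \sum_(g in isom_set bar B) jkernel bar eps B mu g *: sigma g =
    (sq ^+ dimF_lie bar B * a)%:M.
Proof.
rewrite Jmx_jkernel => /(congr1 (fun M => sq ^+ dimF_lie bar B *: M)).
by rewrite scalerA mulfV ?expf_neq0 ?sq_neq0 // scale1r scale_scalar_mx.
Qed.

(** Comparing exponents of [q], the dimension for [B] is the sum of those for [B1] and [B2] plus
    [2 k]; as [N] equals [sq] to the power [2 k] in [C], all powers of [sq] cancel. *)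
Lemma Jmx_normalization n (B : 'M[E]_n) n1 (B1 : 'M[E]_n1) n2 (B2 : 'M[E]_n2)
    (N k : nat) (a b : C) :
  N = (qF bar ^ k)%N ->
  #|lie_set bar B| = (#|lie_set bar B1| * #|lie_set bar B2| * N ^ 2)%N ->
  sq ^- dimF_lie bar B *
    (N%:R * ((sq ^+ dimF_lie bar B1 * a) * (sq ^+ dimF_lie bar B2 * b))) = a * b.
Proof.
move=> ->; rewrite !card_lie_set -expnM -!expnD.
move/(congr1 (trunc_log (qF bar))); rewrite !trunc_expnK ?qF_gt1 // => ->.
rewrite natrX -sq_def -exprM (mulnC 2) !exprD.
have nz i : sq ^+ i != 0 by rewrite expf_neq0 ?sq_neq0.
move: (nz (dimF_lie bar B1)) (nz (dimF_lie bar B2)) (nz (k * 2)%N).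
move: (sq ^+ _) (sq ^+ _) (sq ^+ _) => x y z nzx nzy nzz.
by field; rewrite nzx nzy nzz.
Qed.
End Normalization.

(** * The zero form: parabolic, unipotent radical and cuspidality in GL(V) *)

Section ZeroForm.
Variables (E : finFieldType) (bar : {rmorphism E -> E}) (m n0 : nat).

Lemma parab_z_group_set : group_set (parab_z E m n0).
Proof.
apply/group_setP; split.
  by rewrite inE glmx1 scalar_mx_block block_mxKdl.
move=> x y; rewrite !inE glmxM => /eqP x0 /eqP y0.
by have [-> _ _] := mulmx_ublock x0 y0.
Qed.
Canonical parab_z_group := Group parab_z_group_set.

Lemma glmx_levi_X_z p : p \in parab_z E m n0 ->
  glmx (levi_X_z p) = ulsubmx (glmx p).
Proof. by rewrite inE => /eqP/glmx_block_unit/andP[? _]; apply: glmx_toGL. Qed.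

Lemma glmx_levi_V0_z p : p \in parab_z E m n0 ->
  glmx (levi_V0_z p) = drsubmx (glmx p).
Proof. by rewrite inE => /eqP/glmx_block_unit/andP[_ ?]; apply: glmx_toGL. Qed.

Lemma levi_X_zM : {in parab_z_group &, {morph @levi_X_z E m n0 : x y / (x * y)%g}}.
Proof.
move=> x y Px Py; apply: val_inj; rewrite /= !glmx_levi_X_z ?groupM // glmxM.
move: Px Py; rewrite !inE => /eqP x0 /eqP y0.
by have [_ -> _] := mulmx_ublock x0 y0.
Qed.

Lemma levi_V0_zM : {in parab_z_group &, {morph @levi_V0_z E m n0 : x y / (x * y)%g}}.
Proof.
move=> x y Px Py; apply: val_inj; rewrite /= !glmx_levi_V0_z ?groupM // glmxM.
move: Px Py; rewrite !inE => /eqP x0 /eqP y0.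
by have [_ _ ->] := mulmx_ublock x0 y0.
Qed.

Definition levi_z (a : GLt E m) (h : GLt E n0) : GLt E (m + n0) :=
  toGL (block_mx (glmx a) 0 0 (glmx h)).

Lemma glmx_levi_z a h : glmx (levi_z a h) = block_mx (glmx a) 0 0 (glmx h).
Proof.
by apply: glmx_toGL; rewrite unitmxE det_ublock unitrM -!unitmxE !glmx_unit.
Qed.

Lemma levi_z_in a h : levi_z a h \in parab_z E m n0.
Proof. by rewrite inE glmx_levi_z block_mxKdl. Qed.

Lemma levi_X_levi_z a h : levi_X_z (levi_z a h) = a.
Proof.
by apply: val_inj; rewrite /= glmx_levi_X_z ?levi_z_in // glmx_levi_z block_mxKul.
Qed.

Lemma levi_V0_levi_z a h : levi_V0_z (levi_z a h) = h.
Proof.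
by apply: val_inj; rewrite /= glmx_levi_V0_z ?levi_z_in // glmx_levi_z block_mxKdr.
Qed.

Let N := unip_radical parab_z_group (@levi_X_z E m n0) (@levi_V0_z E m n0).

Lemma unip_zP (g : GLt E (m + n0)) :
  reflect (exists Z, glmx g = block_mx 1%:M Z 0 1%:M) (g \in N).
Proof.
rewrite inE; apply: (iffP and3P) => [[Pg /eqP Xg /eqP V0g] | [Z eg]].
  exists (ursubmx (glmx g)); rewrite -[LHS]submxK.
  have := glmx_levi_X_z Pg; have := glmx_levi_V0_z Pg.
  rewrite Xg V0g !glmx1 => <- <-.
  by move: Pg; rewrite inE => /eqP->.
have Pg : g \in parab_z E m n0 by rewrite inE eg block_mxKdl.
split=> //; apply/eqP/val_inj => /=.
  by rewrite glmx_levi_X_z // eg block_mxKul.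
by rewrite glmx_levi_V0_z // eg block_mxKdr.
Qed.

Lemma card_unip_z : #|N| = #|[set: 'M[E]_(m, n0)]|.
Proof.
pose f (Z : 'M[E]_(m, n0)) : GLt E (m + n0) := toGL (block_mx 1%:M Z 0 1%:M).
have fE Z : glmx (f Z) = block_mx 1%:M Z 0 1%:M.
  by apply: glmx_toGL; rewrite unitmxE det_ublock !det1 mulr1 unitr1.
have f_inj : injective f.
  move=> Z1 Z2 /(congr1 (@glmx _ _)); rewrite !fE.
  by case/eq_block_mx.
rewrite -(card_imset _ f_inj); apply: eq_card => g.
apply/unip_zP/imsetP => [[Z eg] | [Z _ ->]]; last by exists Z; rewrite fE.
by exists Z; rewrite ?inE //; apply: val_inj; rewrite /= eg fE.
Qed.

Lemma lie_set0 n : lie_set bar (0 : 'M_n) = setT.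
Proof. by apply/setP => A; rewrite !inE mulmx0 mul0mx addr0 eqxx. Qed.

Lemma card_lie_z : #|lie_set bar (0 : 'M_(m + n0))| =
  (#|lie_set bar (0 : 'M_m)| * #|lie_set bar (0 : 'M_n0)| * #|N| ^ 2)%N.
Proof.
rewrite card_unip_z !lie_set0 !cardsT !card_mx -expnM -!expnD.
by congr (_ ^ _)%N; lia.
Qed.

Variables (C : fieldType) (mu : E -> C).
Hypothesis mu_char : is_charE mu.

(** The matrix [1 + n * levi_z a h] is block upper triangular with diagonal blocks [1 + a] and
    [1 + h]. *)
Lemma jkernel_levi_z : {in N, forall n, forall a h,
  jkernel bar 1 (0 : 'M_(m + n0)) mu (n * levi_z a h)%g =
  jkernel bar 1 (0 : 'M_m) mu a * jkernel bar 1 (0 : 'M_n0) mu h}.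
Proof.
move=> n /unip_zP[Z en] a h; rewrite /jkernel !in_G0_set0 !andTb glmxM en glmx_levi_z.
rewrite mulmx_block !mul1mx !mul0mx !mulmx0 !addr0 !add0r.
rewrite (scalar_mx_block m n0 1) add_block_mx addr0 det_ublock mulf_eq0.
case: eqP => [_|/eqP nz1]; first by rewrite mul0r.
case: eqP => [_|/eqP nz2] /=; first by rewrite mulr0.
by case: mu_char => _ ->.
Qed.

Lemma jkernel_cusp_z (u : E) y : u != 0 -> mu u != 1 -> y \notin parab_z E m n0 ->
  \sum_(n in N) jkernel bar 1 (0 : 'M_(m + n0)) mu (n * y)%g = 0.
Proof.
move=> nzu mu_u nPy; pose J : 'M[E]_(m + n0, m) := col_mx 1%:M 0.
have rankJ : \rank J = m.
  by rewrite -mxrank_tr tr_col_mx trmx1 trmx0; apply/eqP/row_freeP; exists J; rewrite mul_row_col mul1mx mul0mx addr0.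
have [|w [x [w0 wx]]] := exists_functional_value (g := glmx y) (u - 1) rankJ.
  move=> Q; rewrite -[glmx y]submxK mul_block_col mul_col_mx mul1mx mul0mx.
  rewrite !mulmx1 !mulmx0 !addr0 => /eq_col_mx[_ y0].
  by case/negP: nPy; rewrite inE y0.
pose L := 1%:M + (J *m x) *m w.
have detL : \det L = u by rewrite det_add_col_row wx mxE eqxx addrC subrK.
apply: (jkernel_cusp 1 (L := L) (R := 1%:M)) => //.
- by rewrite unitmxE detL unitfE.
- exact: unitmx1.
- by rewrite detL det1 mulr1.
- by rewrite isom_set0 subsetT.
- by move=> n; apply: unip_radicalV; [exact: levi_X_zM | exact: levi_V0_zM].
- by move=> n /unip_zP[Z ->]; rewrite det_ublock !det1 mulr1.
- by rewrite isom_set0 inE.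
move=> n /unip_zP[Z en].
have nJ : glmx n *m J = J.
  by rewrite en mul_block_col !mul1mx mul0mx mulmx0 !addr0.
pose W : 'rV[E]_(m + n0) := w *m (glmx n + glmx y).
(* As [w] kills [(1 + y) X] and [n] fixes X pointwise, [W] vanishes on X. Hence
   [L (n + y) - y = n + xi W] differs from [n] only in the upper right block. *)
have eW : W = row_mx 0 (rsubmx W).
  rewrite -[LHS]hsubmxK; congr row_mx.
  transitivity (W *m J); last by rewrite /W -mulmxA mulmxDl nJ -[J in J + _]mul1mx -mulmxDl.
  by rewrite -[W in RHS]hsubmxK mul_row_col mulmx1 mulmx0 addr0.
have e : L *m (glmx n + glmx y) *m 1%:M - glmx y = block_mx 1%:M (Z + x *m rsubmx W) 0 1%:M.
  rewrite mulmx1 mulmxDl mul1mx -mulmxA -/W addrAC addrK eW mul_col_mx mul1mx mul0mx.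
  by rewrite mul_col_row mulmx0 !mul0mx en add_block_mx !addr0 row_mxKr.
pose n' : GLt E (m + n0) := toGL (block_mx 1%:M (Z + x *m rsubmx W) 0 1%:M).
exists n'.
  apply/unip_zP; exists (Z + x *m rsubmx W); apply: glmx_toGL.
  by rewrite unitmxE det_ublock !det1 mulr1 unitr1.
by rewrite e glmx_toGL // unitmxE det_ublock !det1 mulr1 unitr1.
Qed.

End ZeroForm.

(** * Calculus of three-by-three block matrices *)

Section ThreeBlocks.
Variables m n : nat.

(** Nested exactly like [form_full], so that the Gram matrix of V is an instance by conversion. *)
Definition mx3 (R : Type) (a11 : 'M[R]_m) (a12 : 'M[R]_(m, n)) (a13 : 'M[R]_m)
    (a21 : 'M[R]_(n, m)) (a22 : 'M[R]_n) (a23 : 'M[R]_(n, m))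
    (a31 : 'M[R]_m) (a32 : 'M[R]_(m, n)) (a33 : 'M[R]_m) : 'M[R]_(m + n + m) :=
  block_mx (block_mx a11 a12 a21 a22) (col_mx a13 a23) (row_mx a31 a32) a33.

Lemma mx3K (R : Type) (A : 'M[R]_(m + n + m)) :
  A = mx3 (ulsubmx (ulsubmx A)) (ursubmx (ulsubmx A)) (usubmx (ursubmx A))
          (dlsubmx (ulsubmx A)) (drsubmx (ulsubmx A)) (dsubmx (ursubmx A))
          (lsubmx (dlsubmx A)) (rsubmx (dlsubmx A)) (drsubmx A).
Proof. by rewrite /mx3 submxK vsubmxK hsubmxK submxK. Qed.

Lemma mx3P (R : Type) (A : 'M[R]_(m + n + m)) :
  exists a11 a12 a13 a21 a22 a23 a31 a32 a33,
    A = mx3 a11 a12 a13 a21 a22 a23 a31 a32 a33.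
Proof. by do 9!eexists; apply: mx3K. Qed.

Lemma eq_mx3 (R : Type) (a11 : 'M[R]_m) a12 a13 a21 a22 a23 a31 a32 a33
    b11 b12 b13 b21 b22 b23 b31 b32 b33 :
  mx3 a11 a12 a13 a21 a22 a23 a31 a32 a33 = mx3 b11 b12 b13 b21 b22 b23 b31 b32 b33 ->
  [/\ [/\ a11 = b11, a12 = b12 & a13 = b13], [/\ a21 = b21, a22 = b22 & a23 = b23] &
      [/\ a31 = b31, a32 = b32 & a33 = b33]].
Proof.
by case/eq_block_mx => /eq_block_mx[-> -> -> ->] /eq_col_mx[-> ->]
  /eq_row_mx[-> ->] ->.
Qed.

Lemma tr_mx3 (R : Type) (a11 : 'M[R]_m) a12 a13 a21 a22 a23 a31 a32 a33 :
  (mx3 a11 a12 a13 a21 a22 a23 a31 a32 a33)^T =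
  mx3 a11^T a21^T a31^T a12^T a22^T a32^T a13^T a23^T a33^T.
Proof. by rewrite /mx3 !tr_block_mx tr_col_mx tr_row_mx. Qed.

Lemma map_mx3 (R S : Type) (f : R -> S) (a11 : 'M[R]_m) a12 a13 a21 a22 a23 a31 a32 a33 :
  map_mx f (mx3 a11 a12 a13 a21 a22 a23 a31 a32 a33) =
  mx3 (map_mx f a11) (map_mx f a12) (map_mx f a13) (map_mx f a21) (map_mx f a22)
      (map_mx f a23) (map_mx f a31) (map_mx f a32) (map_mx f a33).
Proof. by rewrite /mx3 !map_block_mx map_col_mx map_row_mx. Qed.

Lemma add_mx3 (R : nmodType) (a11 : 'M[R]_m) a12 a13 a21 a22 a23 a31 a32 a33
    b11 b12 b13 b21 b22 b23 b31 b32 b33 :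
  mx3 a11 a12 a13 a21 a22 a23 a31 a32 a33 + mx3 b11 b12 b13 b21 b22 b23 b31 b32 b33 =
  mx3 (a11 + b11) (a12 + b12) (a13 + b13) (a21 + b21) (a22 + b22) (a23 + b23)
      (a31 + b31) (a32 + b32) (a33 + b33).
Proof. by rewrite /mx3 !add_block_mx add_col_mx add_row_mx. Qed.

Lemma mul_mx3 (R : pzRingType) (a11 : 'M[R]_m) a12 a13 a21 a22 a23 a31 a32 a33
    b11 b12 b13 b21 b22 b23 b31 b32 b33 :
  mx3 a11 a12 a13 a21 a22 a23 a31 a32 a33 *m mx3 b11 b12 b13 b21 b22 b23 b31 b32 b33 =
  mx3 (a11 *m b11 + a12 *m b21 + a13 *m b31) (a11 *m b12 + a12 *m b22 + a13 *m b32)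
      (a11 *m b13 + a12 *m b23 + a13 *m b33)
      (a21 *m b11 + a22 *m b21 + a23 *m b31) (a21 *m b12 + a22 *m b22 + a23 *m b32)
      (a21 *m b13 + a22 *m b23 + a23 *m b33)
      (a31 *m b11 + a32 *m b21 + a33 *m b31) (a31 *m b12 + a32 *m b22 + a33 *m b32)
      (a31 *m b13 + a32 *m b23 + a33 *m b33).
Proof.
rewrite /mx3 !mulmx_block mul_col_row add_block_mx mul_block_col mul_col_mx.
by rewrite add_col_mx mul_row_block mul_mx_row add_row_mx mul_row_col.
Qed.

Lemma mx3_1 (R : pzSemiRingType) : 1%:M = mx3 (1%:M : 'M[R]_m) 0 0 0 1%:M 0 0 0 1%:M.
Proof. by rewrite /mx3 row_mx0 col_mx0 -!scalar_mx_block. Qed.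

Lemma mx3_0 (R : nmodType) : 0 = mx3 (0 : 'M[R]_m) 0 0 0 0 0 0 0 0.
Proof. by rewrite /mx3 row_mx0 col_mx0 !block_mx0. Qed.

Lemma det_umx3 (R : comPzRingType) (a : 'M[R]_m) z1 z2 h z3 c :
  \det (mx3 a z1 z2 0 h z3 0 0 c) = \det a * \det h * \det c.
Proof. by rewrite /mx3 row_mx0 !det_ublock. Qed.

End ThreeBlocks.

(** * The nondegenerate form: parabolic, Levi and unipotent radical *)

Section Form.
Variables (E : finFieldType) (bar : {rmorphism E -> E}) (eps : E) (m n0 : nat).
Variable B0 : 'M[E]_n0.
Hypothesis bar_invol : forall x : E, bar (bar x) = x.
Hypothesis eps_sqr : eps * eps = 1.
Hypothesis bar_eps : bar eps = eps.
Hypothesis B0_unit : B0 \in unitmx.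
Hypothesis B0_tr : B0^T = eps *: map_mx bar B0.

Local Notation "A ^b" := (map_mx bar A) (at level 2, format "A ^b").
Local Notation B := (form_full eps m B0).

Lemma map_mx_barK p r (A : 'M[E]_(p, r)) : A^b^b = A.
Proof. by apply/matrixP => i j; rewrite !mxE bar_invol. Qed.

Lemma tr_map_bar p r (A : 'M[E]_(p, r)) : (A^b)^T = (A^T)^b.
Proof. by apply/matrixP => i j; rewrite !mxE. Qed.

Lemma B0_barT : (B0^b)^T = eps *: B0.
Proof.
by rewrite tr_map_bar B0_tr map_mxZ bar_eps map_mx_barK.
Qed.

Lemma form_full_mx3 : B = mx3 0 0 1%:M 0 B0 0 eps%:M 0 0.
Proof. by []. Qed.

Lemma form_full_tr : B^T = eps *: B^b.
Proof.
rewrite form_full_mx3 tr_mx3 map_mx3 !trmx0 !map_mx0 trmx1 map_mx1.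
rewrite tr_scalar_mx map_scalar_mx bar_eps B0_tr /mx3 !scale_block_mx.
rewrite scale_col_mx scale_row_mx !scaler0 !scale_scalar_mx eps_sqr mulr1.
by [].
Qed.

Lemma form_full_unit : B \in unitmx.
Proof.
have /mulmx1_unit[] // : B *m mx3 0 0 eps%:M 0 (invmx B0) 0 1%:M 0 0 = 1%:M.
rewrite form_full_mx3 mul_mx3 mx3_1 ?(mul0mx, mulmx0, mul1mx, mulmx1, addr0, add0r).
by rewrite mulmxV // -scalar_mxM eps_sqr.
Qed.

(** Comparing this with the blocks of [B] turns membership of a triangular matrix in the isometry
    group into equations between its blocks. *)
Lemma gram_umx3 a z1 z2 h z3 c :
  (mx3 a z1 z2 0 h z3 0 0 c)^T *m B *m (mx3 a z1 z2 0 h z3 0 0 c)^b =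
  mx3 0 0 (a^T *m c^b) 0 (h^T *m B0 *m h^b) (z1^T *m c^b + h^T *m B0 *m z3^b)
    (eps *: (c^T *m a^b)) (z3^T *m B0 *m h^b + eps *: (c^T *m z1^b))
    (z2^T *m c^b + z3^T *m B0 *m z3^b + eps *: (c^T *m z2^b)).
Proof.
rewrite form_full_mx3 tr_mx3 map_mx3 !mul_mx3 !trmx0 !map_mx0.
rewrite ?(mul0mx, mulmx0, mulmx1, addr0, add0r) !mul_mx_scalar -!scalemxAl.
by congr mx3; rewrite addrC // addrA addrAC.
Qed.

(** An isometry preserving X preserves its orthogonal, the sum of X and V0: the top row of the Gram
    identity makes [a11] invertible and gives [a11^T a32^b = 0]. *)
Lemma gram_mx3_row1 a11 a12 a13 a22 a23 a32 a33 :
  (mx3 a11 a12 a13 0 a22 a23 0 a32 a33)^T *m B *m (mx3 a11 a12 a13 0 a22 a23 0 a32 a33)^b = B ->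
  a32 = 0.
Proof.
rewrite form_full_mx3 tr_mx3 map_mx3 !mul_mx3 !trmx0 !map_mx0.
rewrite ?(mul0mx, mulmx0, mulmx1, addr0, add0r) => /eq_mx3[[_ e12 e13] _ _].
have [ua _] := mulmx1_unit e13.
have a0 : a32^b = 0 by rewrite -(mulKmx ua a32^b) e12 mulmx0.
by rewrite -[a32]map_mx_barK a0 map_mx0.
Qed.

Lemma isom_umx3P g a z1 z2 h z3 c : glmx g = mx3 a z1 z2 0 h z3 0 0 c ->
  g \in isom_set bar B -> [/\ a^T *m c^b = 1%:M, h^T *m B0 *m h^b = B0 &
    z1^T *m c^b + h^T *m B0 *m z3^b = 0 /\
    z2^T *m c^b + z3^T *m B0 *m z3^b + eps *: (c^T *m z2^b) = 0].
Proof.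
move=> eg; rewrite inE eg gram_umx3 form_full_mx3 => /eqP/eq_mx3.
by case=> [[_ _ ->] [_ -> ->] [_ _ ->]].
Qed.

Lemma parab_ndP g : reflect (g \in isom_set bar B /\
    exists a z1 z2 h z3 c, glmx g = mx3 a z1 z2 0 h z3 0 0 c)
  (g \in parab_nd bar eps m B0).
Proof.
rewrite [g \in parab_nd _ _ _ _]inE.
apply: (iffP and3P) => [[Gg /eqP e1 /eqP e2] | [Gg]].
  split=> //; rewrite (mx3K (glmx g)) e1 e2 linear0 linear0.
  by do 6!eexists.
move=> [a [z1 [z2 [h [z3 [c eg]]]]]]; split=> //; rewrite eg.
  by rewrite block_mxKdl row_mx0.
by rewrite block_mxKul block_mxKdl.
Qed.

Lemma parab_nd_group_set : group_set (parab_nd bar eps m B0).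
Proof.
apply/group_setP; split.
  apply/parab_ndP; split; first exact: (group1 (isom_group bar B)).
  by rewrite glmx1 mx3_1; do 6!eexists.
move=> x y /parab_ndP[Gx [a [z1 [z2 [h [z3 [c ex]]]]]]].
case/parab_ndP=> Gy [a' [z1' [z2' [h' [z3' [c' ey]]]]]].
apply/parab_ndP; split; first exact: (groupM Gx Gy : _ \in isom_group bar B).
rewrite glmxM ex ey mul_mx3 ?(mul0mx, mulmx0, addr0, add0r).
by do 6!eexists.
Qed.
Canonical parab_nd_group := Group parab_nd_group_set.

Lemma parab_nd_sub : parab_nd bar eps m B0 \subset isom_set bar B.
Proof. by apply/subsetP => g /parab_ndP[]. Qed.

Lemma glmx_levi_nd (p : GLt E (m + n0 + m)) a z1 z2 h z3 c : glmx p = mx3 a z1 z2 0 h z3 0 0 c ->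
  glmx (levi_X_nd p) = a /\ glmx (levi_V0_nd p) = h.
Proof.
move=> ep; have := glmx_unit p; rewrite ep unitmxE det_umx3 !unitrM -!unitmxE.
case/andP=> /andP[ua uh] _.
by rewrite /levi_X_nd /levi_V0_nd ep block_mxKul block_mxKul block_mxKdr !glmx_toGL.
Qed.

Lemma levi_X_ndM :
  {in parab_nd_group &, {morph @levi_X_nd E m n0 : x y / (x * y)%g}}.
Proof.
move=> x y /parab_ndP[_ [a [z1 [z2 [h [z3 [c ex]]]]]]].
case/parab_ndP=> _ [a' [z1' [z2' [h' [z3' [c' ey]]]]]].
apply: val_inj => /=; rewrite (glmx_levi_nd ex).1 (glmx_levi_nd ey).1.
have exy : glmx (x * y)%g = glmx x *m glmx y by [].
rewrite ex ey mul_mx3 ?(mul0mx, mulmx0, addr0, add0r) in exy.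
by rewrite (glmx_levi_nd exy).1.
Qed.

Lemma levi_V0_ndM :
  {in parab_nd_group &, {morph @levi_V0_nd E m n0 : x y / (x * y)%g}}.
Proof.
move=> x y /parab_ndP[_ [a [z1 [z2 [h [z3 [c ex]]]]]]].
case/parab_ndP=> _ [a' [z1' [z2' [h' [z3' [c' ey]]]]]].
apply: val_inj => /=; rewrite (glmx_levi_nd ex).2 (glmx_levi_nd ey).2.
have exy : glmx (x * y)%g = glmx x *m glmx y by [].
rewrite ex ey mul_mx3 ?(mul0mx, mulmx0, addr0, add0r) in exy.
by rewrite (glmx_levi_nd exy).2.
Qed.

Lemma levi_V0_nd_in p : p \in parab_nd bar eps m B0 -> levi_V0_nd p \in isom_set bar B0.
Proof.
case/parab_ndP=> Gp [a [z1 [z2 [h [z3 [c ep]]]]]].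
have [_ eh _] := isom_umx3P ep Gp.
by rewrite inE (glmx_levi_nd ep).2 eh.
Qed.

(** The action [c] on Y is forced by the duality with X, that is by [a^T c^b = 1]. *)
Definition levi_nd (a : GLt E m) (h : GLt E n0) : GLt E (m + n0 + m) :=
  toGL (mx3 (glmx a) 0 0 0 (glmx h) 0 0 0 (invmx (glmx a)^T)^b).

Lemma glmx_levi_ndE a h :
  glmx (levi_nd a h) = mx3 (glmx a) 0 0 0 (glmx h) 0 0 0 (invmx (glmx a)^T)^b.
Proof.
apply: glmx_toGL; rewrite unitmxE det_umx3 !unitrM -!unitmxE !glmx_unit /=.
by rewrite map_unitmx unitmx_inv unitmx_tr glmx_unit.
Qed.

Lemma levi_nd_in a h : h \in isom_set bar B0 -> levi_nd a h \in parab_nd bar eps m B0.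
Proof.
rewrite inE => /eqP eh; apply/parab_ndP; split; last first.
  by rewrite glmx_levi_ndE; do 6!eexists.
rewrite inE glmx_levi_ndE gram_umx3 form_full_mx3 eh map_mx_barK.
rewrite !trmx0 !map_mx0 ?(mul0mx, mulmx0, addr0, add0r, scaler0).
have uT : (glmx a)^T \in unitmx by rewrite unitmx_tr glmx_unit.
rewrite mulmxV // tr_map_bar -map_mxM trmx_inv trmxK mulVmx ?glmx_unit //.
by rewrite map_mx1 scalemx1.
Qed.

Lemma levi_X_levi_nd a h : levi_X_nd (levi_nd a h) = a.
Proof. by apply: val_inj; rewrite /= (glmx_levi_nd (glmx_levi_ndE a h)).1. Qed.

Lemma levi_V0_levi_nd a h : levi_V0_nd (levi_nd a h) = h.
Proof. by apply: val_inj; rewrite /= (glmx_levi_nd (glmx_levi_ndE a h)).2. Qed.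

Definition unip_nd :=
  unip_radical parab_nd_group (@levi_X_nd E m n0) (@levi_V0_nd E m n0).

(** The Levi projections see only X and V0, so the block [c] on Y is left free here; the isometry
    condition makes it 1 in [unip_nd_c]. *)
Lemma unip_ndP g : reflect (g \in isom_set bar B /\
    exists z1 z2 z3 c, glmx g = mx3 1%:M z1 z2 0 1%:M z3 0 0 c) (g \in unip_nd).
Proof.
rewrite [g \in unip_nd]inE; apply: (iffP and3P) => [[/parab_ndP[Gg]] | [Gg [z1 [z2 [z3 [c eg]]]]]].
  move=> [a [z1 [z2 [h [z3 [c eg]]]]]] /eqP ea /eqP eh; split=> //.
  have [] := glmx_levi_nd eg; rewrite ea eh !glmx1 => e1 e2.
  by exists z1, z2, z3, c; rewrite eg -e1 -e2.
have [e1 e2] := glmx_levi_nd eg.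
split; first by apply/parab_ndP; split=> //; rewrite eg; do 6!eexists.
  by apply/eqP/val_inj.
by apply/eqP/val_inj.
Qed.

Lemma unip_nd_c z1 z2 z3 c g : g \in isom_set bar B ->
  glmx g = mx3 1%:M z1 z2 0 1%:M z3 0 0 c -> c = 1%:M.
Proof.
move=> Gg eg; have [ec _ _] := isom_umx3P eg Gg.
by rewrite -[c]map_mx_barK -[c^b]mul1mx -[1%:M in LHS]trmx1 ec map_mx1.
Qed.

End Form.

(** * Why the bijection of the unipotent radical stays among isometries *)

Section Cusp.
Variables (E : finFieldType) (bar : {rmorphism E -> E}) (eps : E).
Hypothesis bar_invol : forall x : E, bar (bar x) = x.
Hypothesis eps_sqr : eps * eps = 1.
Hypothesis bar_eps : bar eps = eps.

Local Notation "A ^b" := (map_mx bar A) (at level 2, format "A ^b").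

(* Here [w = <., eta>] and [mu = <., xi>] for [<x, y> = x^T B (bar y)]. *)
Lemma isom_transvection D (B n y yi L R : 'M[E]_D) (xi eta zeta : 'cV[E]_D)
    (w mu : 'rV[E]_D) (u : E) :
  B^T = eps *: B^b ->
  n^T *m B *m n^b = B -> y^T *m B *m y^b = B -> y *m yi = 1%:M ->
  B *m eta^b = w^T -> B *m xi^b = mu^T -> zeta = - eps *: (yi *m eta) ->
  mu *m xi = 0 -> mu *m n = mu ->
  w *m xi = (u - 1)%:M -> mu *m zeta = (bar u - 1)%:M ->
  L = 1%:M + xi *m w -> R = 1%:M + zeta *m mu ->
  let n' := L *m (n + y) *m R - y in n'^T *m B *m n'^b = B.
Proof.
move=> Btr nB yB yyi eB xB def_zeta mu_xi mu_n w_xi mu_zeta -> ->.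
set L0 := 1%:M + xi *m w; set R0 := 1%:M + zeta *m mu.
set T := n + y; set W := w *m T.
have BbT : (B^b)^T = eps *: B.
  by rewrite tr_map_bar Btr map_mxZ bar_eps map_mx_barK.
have xiB : xi^T *m B = eps *: mu^b.
  rewrite -[mu]trmxK -xB -tr_map_bar map_mxM map_mx_barK // trmx_mul BbT.
  by rewrite -scalemxAr scalerA eps_sqr scale1r.
have etaB : eta^T *m B = eps *: w^b.
  rewrite -[w]trmxK -eB -tr_map_bar map_mxM map_mx_barK // trmx_mul BbT.
  by rewrite -scalemxAr scalerA eps_sqr scale1r.
have LB : L0^T *m B = B + eps *: (w^T *m mu^b).
  by rewrite /L0 linearD /= trmx1 trmx_mul mulmxDl mul1mx -mulmxA xiB scalemxAr.
have BL : B *m L0^b = B + mu^T *m w^b.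
  by rewrite /L0 map_mxD map_mx1 map_mxM mulmxDr mulmx1 mulmxA xB.
have muL : mu *m L0 = mu.
  by rewrite /L0 mulmxDr mulmx1 mulmxA mu_xi mul0mx addr0.
have wL : w *m L0 = u *: w.
  rewrite /L0 mulmxDr mulmx1 mulmxA w_xi mul_scalar_mx scalerBl scale1r.
  by rewrite addrC subrK.
have muR : mu *m R0 = bar u *: mu.
  rewrite /R0 mulmxDr mulmx1 mulmxA mu_zeta mul_scalar_mx scalerBl scale1r.
  by rewrite addrC subrK.
have yR : y *m R0 = y - eps *: (eta *m mu).
  rewrite /R0 mulmxDr mulmx1 mulmxA def_zeta -scalemxAr mulmxA yyi mul1mx.
  by rewrite scaleNr mulNmx -scalemxAl.
have ByR : B *m y^b = B *m y^b *m R0^b + eps *: (w^T *m mu^b).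
  rewrite -mulmxA -map_mxM yR map_mxB map_mxZ bar_eps map_mxM mulmxBr -scalemxAr.
  by rewrite mulmxA eB subrK.
have RyB : y^T *m B = R0^T *m (y^T *m B) + mu^T *m w^b.
  rewrite mulmxA -trmx_mul yR linearB /= linearZ /= trmx_mul mulmxBl -scalemxAl.
  by rewrite -mulmxA etaB -scalemxAr scalerA eps_sqr scale1r subrK.
(* Given that [y] is an isometry, [T - y] is one exactly when this identity holds; the rest of the
   proof transports it from [T] to [T' = L0 T R0]. *)
have TBT : T^T *m B *m T^b = T^T *m B *m y^b + y^T *m B *m T^b.
  rewrite /T linearD /= map_mxD !mulmxDl !mulmxDr nB yB.
  by rewrite [B + _]addrC.
have muT : mu *m T = mu + mu *m y by rewrite /T mulmxDr mu_n.
have muTT : (mu *m T)^T = mu^T + y^T *m mu^T by rewrite muT linearD /= trmx_mul.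
have TLB : T^T *m L0^T *m B = T^T *m B + eps *: (W^T *m mu^b).
  by rewrite -mulmxA LB mulmxDr -scalemxAr mulmxA -trmx_mul.
have BLT : B *m (L0^b *m T^b) = B *m T^b + mu^T *m W^b.
  by rewrite mulmxA BL mulmxDl -mulmxA -map_mxM.
have wLT : w *m (L0 *m T) = u *: W by rewrite mulmxA wL -scalemxAl.
clearbody W; clearbody T L0 R0; set T' := L0 *m T *m R0.
(* Up to the outer factors [R0^T] and [R0^b], the left side of the identity gains two rank-one
   corrections; [e2] and [e3] show that each term on the right gains one of them. *)
have e1 : T'^T *m B *m T'^b = R0^T *m (T^T *m B *m T^b +
    (mu *m T)^T *m W^b + eps *: (W^T *m (mu *m T)^b)) *m R0^b.
  transitivity (R0^T *m ((T^T *m L0^T *m B) *m (L0^b *m T^b)) *m R0^b).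
    by rewrite /T' !trmx_mul !map_mxM !mulmxA.
  congr (_ *m _ *m _); rewrite TLB mulmxDl -[T^T *m B *m _]mulmxA BLT mulmxDr.
  rewrite !mulmxA -trmx_mul -scalemxAl; congr (_ + _).
  by rewrite -scalemxAl -!mulmxA -!map_mxM mulmxA muL.
have e2 : T'^T *m B *m y^b =
    R0^T *m (T^T *m B *m y^b + eps *: (W^T *m (mu *m T)^b)) *m R0^b.
  (* The factor [u] by which [L0] scales [w] is absorbed by [R0], which scales [mu] by [bar u]. *)
  have umu : u *: mu^b = mu^b *m R0^b by rewrite -map_mxM muR map_mxZ bar_invol.
  transitivity (R0^T *m (T^T *m L0^T *m (B *m y^b))).
    by rewrite /T' !trmx_mul !mulmxA.
  rewrite -[RHS]mulmxA; congr (_ *m _); rewrite ByR mulmxDr -scalemxAr !mulmxA TLB.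
  rewrite -trmx_mul -[_ *m w^T]trmx_mul wLT linearZ /= -scalemxAl scalemxAr umu.
  rewrite muT map_mxD map_mxM [RHS]mulmxDl mulmxDr scalerDr.
  rewrite 2!mulmxDl -addrA; congr (_ + _).
  by rewrite mulmxDl addrC -!scalemxAl !mulmxA.
have e3 : y^T *m B *m T'^b =
    R0^T *m (y^T *m B *m T^b + (mu *m T)^T *m W^b) *m R0^b.
  transitivity (y^T *m B *m (L0^b *m T^b) *m R0^b).
    by rewrite /T' !map_mxM !mulmxA.
  congr (_ *m _); rewrite {1}RyB mulmxDl -!mulmxA -!map_mxM wLT map_mxZ -scalemxAr.
  rewrite scalemxAl -linearZ /= -muR [(mu *m R0)^T]trmx_mul map_mxM BLT muTT.
  rewrite -mulmxA -mulmxDr; congr (_ *m _).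
  by rewrite mulmxDr mulmxDl -!mulmxA -addrA [X in _ + X]addrC.
move=> /=; rewrite linearB /= map_mxB !mulmxBl !mulmxBr yB e1 e2 e3 TBT.
set X := R0^T *m _ *m R0^b; set Y := R0^T *m _ *m R0^b; set Z := R0^T *m _ *m R0^b.
suff -> : X = Y + Z by rewrite opprB [Y + Z]addrC addrK addrC subrK.
rewrite /X /Y /Z -mulmxDl -mulmxDr; congr (_ *m _ *m _).
by rewrite -!addrA; congr (_ + _); rewrite [RHS]addrC -addrA.
Qed.
End Cusp.

(** * Cuspidality for the nondegenerate form *)

Section NondegenerateForm.
Variables (E : finFieldType) (bar : {rmorphism E -> E}) (eps : E) (m n0 : nat).
Variable B0 : 'M[E]_n0.
Hypothesis bar_invol : forall x : E, bar (bar x) = x.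
Hypothesis eps_sqr : eps * eps = 1.
Hypothesis bar_eps : bar eps = eps.
Hypothesis B0_unit : B0 \in unitmx.
Hypothesis B0_tr : B0^T = eps *: map_mx bar B0.

Local Notation "A ^b" := (map_mx bar A) (at level 2, format "A ^b").
Local Notation B := (form_full eps m B0).
Local Notation N := (unip_nd bar eps m B0).

Lemma unip_nd_det g : g \in N -> \det (glmx g) = 1.
Proof.
case/unip_ndP=> Gg [z1 [z2 [z3 [c eg]]]].
by rewrite eg (unip_nd_c bar_invol Gg eg) det_umx3 !det1 !mulr1.
Qed.

Variables (C : fieldType) (chi : E -> C).
Hypothesis chi_char : is_charE chi.

Lemma jkernel_cusp_nd (u : E) y : u != 0 -> chi (u * bar u) != 1 ->
  y \in isom_set bar B -> y \notin parab_nd bar eps m B0 ->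
  \sum_(n in N) jkernel bar eps B chi (n * y)%g = 0.
Proof.
move=> nzu chi_u Gy nPy; pose J : 'M[E]_(m + n0 + m, m) := col_mx (col_mx 1%:M 0) 0.
have yB : (glmx y)^T *m B *m (glmx y)^b = B by apply/eqP; move: Gy; rewrite inE.
have rankJ : \rank J = m.
  rewrite -mxrank_tr !tr_col_mx trmx1 !trmx0; apply/eqP/row_freeP; exists J.
  by rewrite !mul_row_col mul1mx !mul0mx !addr0.
have [|w [x [w0 wx]]] := exists_functional_value (g := glmx y) (u - 1) rankJ.
  (* If [y] preserved X, it would preserve the whole flag by [gram_mx3_row1], hence lie in the
     parabolic. *)
  move=> Q eQ; case/negP: nPy; apply/parab_ndP; split=> //.
  have [a [a12 [a13 [a21 [h [a23 [a31 [a32 [a33 ey]]]]]]]]] := mx3P (glmx y).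
  move: eQ; rewrite ey /J /mx3 mul_block_col mul_block_col mul_row_col !mul_col_mx.
  rewrite !mulmx1 !mulmx0 !mul1mx !mul0mx !addr0.
  case/eq_col_mx; rewrite col_mx0 ?addr0 => /eq_col_mx[_ a21_0] a31_0.
  move: ey; rewrite a21_0 a31_0 => ey; move: yB; rewrite ey.
  move/(gram_mx3_row1 bar_invol) => ->.
  by do 6!eexists.
have uB := form_full_unit m eps_sqr B0_unit.
(* [eta] represents the functional [w] through the form, and [mu] is the functional represented by
   [xi]. *)
pose xi := J *m x; pose eta := (invmx B *m w^T)^b; pose mu := (B *m xi^b)^T.
pose yi := glmx y^-1%g; pose zeta := - eps *: (yi *m eta).
pose L := 1%:M + xi *m w; pose R := 1%:M + zeta *m mu.
have Btr := form_full_tr m eps_sqr bar_eps B0_tr.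
have etaB : B *m eta^b = w^T by rewrite /eta map_mx_barK // mulKVmx.
have xiB : B *m xi^b = mu^T by rewrite /mu trmxK.
have xiE : xi = col_mx (col_mx x 0) 0.
  by rewrite /xi /J !mul_col_mx !mul1mx !mul0mx.
have muE : mu = row_mx (row_mx 0 0) (eps *: (x^b)^T).
  rewrite /mu form_full_mx3 xiE !map_col_mx !map_mx0 /mx3.
  rewrite mul_block_col mul_block_col mul_row_col.
  rewrite !mulmx0 !mul0mx !addr0 mul_scalar_mx.
  by rewrite !tr_col_mx !trmx0 linearZ.
have mu_xi : mu *m xi = 0.
  by rewrite muE xiE !mul_row_col !mul0mx mulmx0 !addr0.
have wyx : w *m (glmx y *m xi) = (1 - u)%:M.
  move: w0; rewrite mulmxDl mul1mx mulmxDr => /(congr1 (fun M => M *m x)).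
  rewrite mulmxDl mul0mx -!mulmxA -/xi wx => /eqP; rewrite addr_eq0 => /eqP e.
  by rewrite -[LHS]opprK -e -raddfN /= opprB.
(* Here [<y^-1 eta, xi> = <eta, y xi>], which is [eps] times the conjugate of [<y xi, eta> = 1 - u];
   the factor [- eps] in [zeta] turns it into [bar u - 1]. *)
have mu_zeta : mu *m zeta = (bar u - 1)%:M.
  have By : B^T *m yi = ((glmx y)^b)^T *m B^T.
    rewrite -[in LHS]yB trmx_mul [((_)^T *m B)^T]trmx_mul trmxK -!mulmxA.
    by rewrite glmxV_r mulmx1.
  have Beta : B^T *m eta = eps *: (w^T)^b.
    by rewrite Btr -scalemxAl -[eta](map_mx_barK bar_invol) -map_mxM etaB.
  rewrite /zeta /mu trmx_mul -scalemxAr -!mulmxA (mulmxA B^T) By -mulmxA Beta.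
  rewrite -!scalemxAr scalerA mulNr eps_sqr scaleN1r mulmxA -trmx_mul -map_mxM.
  rewrite -tr_map_bar -trmx_mul -map_mxM wyx map_scalar_mx tr_scalar_mx /=.
  by rewrite -raddfN /= rmorphB rmorph1 opprB.
have detL : \det L = u by rewrite det_add_col_row wx mxE eqxx addrC subrK.
have detR : \det R = bar u.
  by rewrite det_add_col_row mu_zeta mxE eqxx addrC subrK.
have nzbu : bar u != 0 by rewrite fmorph_eq0.
apply: (jkernel_cusp eps (L := L) (R := R)) => //.
- by rewrite unitmxE detL unitfE.
- by rewrite unitmxE detR unitfE.
- by rewrite detL detR.
- by apply/subsetP => g /unip_ndP[].
- by move=> g; apply: unip_radicalV; [exact: levi_X_ndM | exact: levi_V0_ndM].
- by move=> g; apply: unip_nd_det.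
move=> n Nn; have /unip_ndP[Gn [z1 [z2 [z3 [c en]]]]] := Nn.
have nB : (glmx n)^T *m B *m (glmx n)^b = B by apply/eqP; move: Gn; rewrite inE.
have nJ : glmx n *m J = J.
  rewrite en /J /mx3 mul_block_col mul_block_col mul_row_col.
  by rewrite !mulmx1 !mulmx0 !addr0.
(* [n] is an isometry fixing [xi], so [<n v, xi> = <n v, n xi> = <v, xi>]. *)
have mu_n : mu *m glmx n = mu.
  have nxi : glmx n *m xi = xi by rewrite mulmxA nJ.
  have nxib : (xi^b)^T *m ((glmx n)^b)^T = (xi^b)^T by rewrite -trmx_mul -map_mxM nxi.
  rewrite /mu trmx_mul -[in RHS]nB trmx_mul [((_)^T *m B)^T]trmx_mul trmxK.
  by rewrite !mulmxA nxib.
have := isom_transvection bar_invol eps_sqr bar_eps Btr nB yB (glmxV_r y) etaB xiB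
  (erefl zeta) mu_xi mu_n wx mu_zeta (erefl L) (erefl R).
set n' := _ - _ => /= n'B.
pose W : 'rV[E]_(m + n0 + m) := w *m (glmx n + glmx y).
have eW : W = row_mx (row_mx 0 (rsubmx (lsubmx W))) (rsubmx W).
  rewrite -[LHS]hsubmxK -[lsubmx W in LHS]hsubmxK; congr (row_mx (row_mx _ _) _).
  transitivity (W *m J); last first.
    by rewrite /W -mulmxA mulmxDl nJ -[J in J + _]mul1mx -mulmxDl.
  rewrite -[W in RHS]hsubmxK -[lsubmx W in RHS]hsubmxK !mul_row_col.
  by rewrite mulmx1 !mulmx0 !addr0.
have [V en'] : exists V : 'cV_(m + n0 + m), n' = glmx n + xi *m W + V *m mu.
  exists (L *m (glmx n + glmx y) *m zeta).
  rewrite /n' /R mulmxDr mulmx1 mulmxA addrAC; congr (_ + _).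
  by rewrite /L mulmxDl mul1mx -mulmxA -/W addrAC addrK.
(* The term [xi W] has image in X and vanishes on X, while [V mu] vanishes on X and V0, so the
   unipotent shape survives on these two blocks. *)
have n'E : exists z1 z2 z3 c, n' = mx3 1%:M z1 z2 0 1%:M z3 0 0 c.
  rewrite en' en xiE eW muE.
  rewrite -[V]vsubmxK -[usubmx V]vsubmxK !mul_col_row !mul_col_mx !mul_mx_row.
  rewrite !mulmx0 !mul0mx -!/(mx3 _ _ _ _ _ _ _ _ _) !add_mx3 !addr0.
  by do 4!eexists.
have un' : n' \in unitmx.
  move: uB; rewrite -n'B !unitmx_mul => /andP[_]; by rewrite map_unitmx.
exists (toGL n'); rewrite ?glmx_toGL //; apply/unip_ndP.
by rewrite inE glmx_toGL // n'B.
Qed.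

End NondegenerateForm.

(** * Counting the unipotent radical and the Lie algebra, and the weight on the Levi *)

Section NondegenerateCount.
Variables (E : finFieldType) (bar : {rmorphism E -> E}) (eps : E) (m n0 : nat).
Variable B0 : 'M[E]_n0.
Hypothesis bar_invol : forall x : E, bar (bar x) = x.
Hypothesis eps_sqr : eps * eps = 1.
Hypothesis bar_eps : bar eps = eps.
Hypothesis B0_unit : B0 \in unitmx.
Hypothesis B0_tr : B0^T = eps *: map_mx bar B0.
Hypothesis two_nz : 2%:R != 0 :> E.

Local Notation "A ^b" := (map_mx bar A) (at level 2, format "A ^b").
Local Notation B := (form_full eps m B0).
Local Notation N := (unip_nd bar eps m B0).

Definition skew_set : {set 'M[E]_m} := [set S | S^T + eps *: S^b == 0].

Lemma card_unip_nd : #|N| = (#|[set: 'M[E]_(n0, m)]| * #|skew_set|)%N.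
Proof.
have B0b := B0_barT bar_invol bar_eps B0_tr.
(* An element of [N] is determined by its map [z] from Y to V0 and its block from Y to X. The latter
   satisfies an affine equation with particular solution [- (q z)^T], where 2 is inverted, and is
   unique up to [skew_set]. *)
pose q (z : 'M[E]_(n0, m)) := 2%:R^-1 *: (z^T *m B0 *m z^b).
pose mk (zS : 'M[E]_(n0, m) * 'M[E]_m) : 'M[E]_(m + n0 + m) :=
  mx3 1%:M (- (B0 *m zS.1^b)^T) (zS.2 - (q zS.1)^T) 0 1%:M zS.1 0 0 1%:M.
pose f zS : GLt E (m + n0 + m) := toGL (mk zS).
have fE zS : glmx (f zS) = mk zS.
  by apply: glmx_toGL; rewrite unitmxE det_umx3 !det1 !mulr1 unitr1.
have q2 z : q z + q z = z^T *m B0 *m z^b.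
  by rewrite /q -scalerDl -[2%:R^-1]mul1r -mulrDl mulfV ?scale1r.
have qT z : eps *: ((q z)^T)^b = q z.
  rewrite -tr_map_bar /q map_mxZ fmorphV rmorph_nat !map_mxM map_mx_barK //.
  rewrite linearZ /= !trmx_mul B0b -tr_map_bar trmxK -scalemxAl -scalemxAr.
  rewrite scalerA mulrC -scalerA; congr (_ *: _).
  by rewrite scalerA eps_sqr scale1r mulmxA.
have f_inj : {in setX [set: 'M[E]_(n0, m)] skew_set &, injective f}.
  move=> [z S] [z' S'] _ _ /(congr1 (@glmx _ _)); rewrite !fE.
  by case/eq_mx3 => [[_ _ /= e2] [_ _ /= e] _]; move: e2; rewrite e => /addIr->.
rewrite -cardsX -(card_in_imset f_inj); apply: eq_card => g.
apply/unip_ndP/imsetP => [[Gg [z1 [z2 [z3 [c eg]]]]] | [[z S]]].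
  have c1 := unip_nd_c bar_invol Gg eg; rewrite c1 in eg.
  have [_ _ []] := isom_umx3P eg Gg.
  rewrite map_mx1 !trmx1 !mulmx1 !mul1mx => e1 e2.
  exists (z3, z2 + (q z3)^T).
    rewrite !inE /= linearD /= map_mxD scalerDr trmxK qT.
    by rewrite addrACA q2 addrAC e2.
  apply: val_inj; rewrite /= fE eg /mk /= addrK; congr mx3.
  by move/eqP: e1; rewrite addr_eq0 => /eqP/(congr1 trmx); rewrite trmxK linearN.
rewrite !inE /= => /eqP skS ->; split; last by rewrite fE; do 4!eexists.
rewrite fE gram_umx3 form_full_mx3; apply/eqP; congr mx3;
  rewrite ?map_mx1 ?trmx1 ?mul1mx ?mulmx1 //.
- by rewrite linearN /= trmxK addNr.
- by rewrite scalemx1.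
- rewrite map_mxN -tr_map_bar map_mxM map_mx_barK // trmx_mul B0b -scalemxAr.
  by rewrite scalerN scalerA eps_sqr scale1r addrN.
- rewrite linearB /= trmxK map_mxB scalerBr qT -q2.
  by rewrite [S^T - _ + _]addrA subrK addrACA skS subrr addr0.
Qed.

(** [N] is not itself a linear space, but both factors of its parametrization are vector spaces over
    the fixed field. *)
Lemma card_unip_nd_pow : exists k, #|N| = (qF bar ^ k)%N.
Proof.
have [k1 e1] := @card_fixed_submodule E bar n0 m [set: 'M_(n0, m)]
  (in_setT _) (fun _ _ _ _ => in_setT _) (fun _ _ _ _ => in_setT _).
have [||| k2 e2] := @card_fixed_submodule E bar m m skew_set.
- by rewrite inE trmx0 map_mx0 scaler0 addr0.
- move=> x y; rewrite !inE => /eqP ex /eqP ey.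
  by rewrite linearD /= map_mxD scalerDr addrACA ex ey addr0.
- move=> c x ec; rewrite !inE => /eqP ex.
  by rewrite linearZ /= map_mxZ ec scalerA mulrC -scalerA -scalerDr ex scaler0.
by exists (k1 + k2)%N; rewrite card_unip_nd e1 e2 expnD.
Qed.

Lemma lie_mx3 a11 a12 a13 a21 a22 a23 a31 a32 a33 :
  let A := mx3 a11 a12 a13 a21 a22 a23 a31 a32 a33 in
  A^T *m B + B *m A^b =
  mx3 (eps *: a31^T + a31^b) (a21^T *m B0 + a32^b) (a11^T + a33^b)
      (eps *: a32^T + B0 *m a21^b) (a22^T *m B0 + B0 *m a22^b) (a12^T + B0 *m a23^b)
      (eps *: a33^T + eps *: a11^b) (a23^T *m B0 + eps *: a12^b)
      (a13^T + eps *: a13^b).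
Proof.
rewrite /= form_full_mx3 tr_mx3 map_mx3 !mul_mx3 add_mx3.
by rewrite ?(mul0mx, mulmx0, mulmx1, mul1mx, addr0, add0r) !mul_mx_scalar !mul_scalar_mx.
Qed.

(** The block equations leave free [a11], an [a22] in the Lie algebra of V0, and two pairs of a
    rectangular and a skew block. Each pair, one for the nilradical and one for its opposite, has as
    many values as [N] has elements. *)
Lemma card_lie_nd : #|lie_set bar B| =
  (#|lie_set bar (0 : 'M_m)| * #|lie_set bar B0| * #|N| ^ 2)%N.
Proof.
have B0b := B0_barT bar_invol bar_eps B0_tr.
pose f (t : 'M[E]_m * 'M[E]_n0 * ('M[E]_(n0, m) * 'M[E]_m) *
            ('M[E]_(n0, m) * 'M[E]_m)) :=
  let: (a11, a22, (a21, a31), (a23, a13)) := t in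
  mx3 a11 (- (B0 *m a23^b)^T) a13 a21 a22 a23 a31
      (- (a21^T *m B0)^b) (- (a11^T)^b).
pose S := setX (setX (setX [set: 'M[E]_m] (lie_set bar B0))
    (setX [set: 'M[E]_(n0, m)] skew_set)) (setX [set: 'M[E]_(n0, m)] skew_set).
have f_inj : {in S &, injective f}.
  move=> [[[a11 a22] [a21 a31]] [a23 a13]] [[[b11 b22] [b21 b31]] [b23 b13]] _ _.
  by case/eq_mx3 => [[-> _ ->] [-> -> ->] [-> _ _]].
rewrite lie_set0 card_unip_nd -mulnn mulnA -!cardsX -(card_in_imset f_inj).
apply: eq_card => A; apply/idP/imsetP.
  have [a11 [a12 [a13 [a21 [a22 [a23 [a31 [a32 [a33 ->]]]]]]]]] := mx3P A.
  rewrite inE lie_mx3 (mx3_0 m n0) => /eqP/eq_mx3.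
  case=> [[e11 e12 e13] [_ e22 e23] [_ _ e33]].
  exists (a11, a22, (a21, a31), (a23, a13)).
    rewrite !inE /= e22 e33 !eqxx /= ?andbT.
    have /eqP := congr1 (fun M => eps *: M) e11.
    by rewrite scalerDr scalerA eps_sqr scale1r scaler0.
  rewrite /f; congr mx3.
  - by move/eqP: e23; rewrite addr_eq0 => /eqP/(congr1 trmx); rewrite trmxK linearN.
  - move/eqP: e12; rewrite addrC addr_eq0 => /eqP/(congr1 (map_mx bar)).
    by rewrite map_mx_barK // map_mxN.
  - move/eqP: e13; rewrite addrC addr_eq0 => /eqP/(congr1 (map_mx bar)).
    by rewrite map_mx_barK // map_mxN.
case=> [[[[a11 a22] [a21 a31]] [a23 a13]]]; rewrite !inE /=.
case/andP=> /andP[/eqP e22 /eqP e31] /eqP e13 ->.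
rewrite /f lie_mx3 (mx3_0 m n0); apply/eqP; congr mx3 => //.
- have := congr1 (fun M => eps *: M) e31.
  by rewrite scalerDr scalerA eps_sqr scale1r scaler0.
- by rewrite map_mxN map_mx_barK // addrN.
- by rewrite map_mxN map_mx_barK // addrN.
- rewrite linearN /= tr_map_bar trmx_mul trmxK map_mxM -tr_map_bar B0b.
  by rewrite -scalemxAl scalerN scalerA eps_sqr scale1r addNr.
- by rewrite linearN /= trmxK addNr.
- by rewrite linearN /= tr_map_bar trmxK scalerN addNr.
- rewrite map_mxN -tr_map_bar map_mxM map_mx_barK // trmx_mul B0b -scalemxAr.
  by rewrite scalerN scalerA eps_sqr scale1r addrN.
Qed.

Variables (C : fieldType) (chi : E -> C).
Hypothesis chi_char : is_charE chi.

(** The diagonal blocks of [1 + n * levi_nd a h] are [1 + a], [1 + h] and [1 + cc], and the last has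
    determinant [bar (det (1 + a)) / bar (det a)]. This is the source of both the character
    [chi (x * bar x)] and the twist. *)
Lemma jkernel_levi_nd : {in N, forall n, {in setT & isom_set bar B0, forall a h,
  jkernel bar eps B chi (n * levi_nd bar a h)%g =
  jkernel bar 1 (0 : 'M_m) (fun x => chi (x * bar x)) a *
    (chi (bar (\det (glmx a))))^-1 * jkernel bar eps B0 chi h}}.
Proof.
move=> n /unip_ndP[Gn [z1 [z2 [z3 [c en]]]]] a h _ Gh.
have c1 := unip_nd_c bar_invol Gn en; rewrite {}c1 in en.
have Pl := levi_nd_in eps bar_invol a Gh.
have Gp : (n * levi_nd bar a h)%g \in isom_set bar B.
  exact: (groupM Gn (subsetP (parab_nd_sub _ _ _ _) _ Pl) : _ \in isom_group bar B).
pose cc := (invmx (glmx a)^T)^b; pose d := \det (glmx a).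
have [w1 [w2 [w3 ep]]] : exists w1 w2 w3,
    glmx (n * levi_nd bar a h)%g = mx3 (glmx a) w1 w2 0 (glmx h) w3 0 0 cc.
  rewrite glmxM en glmx_levi_ndE mul_mx3.
  rewrite ?(mul0mx, mulmx0, mulmx1, mul1mx, addr0, add0r).
  by do 3!eexists.
have nzd : d != 0 by rewrite -unitfE -unitmxE glmx_unit.
have nzbd : bar d != 0 by rewrite fmorph_eq0.
have detcc : \det cc = (bar d)^-1 by rewrite /cc det_map_mx det_inv det_tr fmorphV.
have det1cc : \det (1%:M + cc) = bar (\det (1%:M + glmx a)) / bar d.
  have -> : 1%:M + cc = cc *m ((1%:M + glmx a)^T)^b.
    rewrite linearD /= trmx1 map_mxD map_mx1 mulmxDr mulmx1 /cc -map_mxM.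
    by rewrite mulVmx ?map_mx1 1?addrC // unitmx_tr glmx_unit.
  by rewrite det_mulmx detcc det_map_mx det_tr mulrC.
rewrite /jkernel in_G0_set0 !in_G0_set Gp Gh !andTb (form_full_unit m eps_sqr B0_unit) B0_unit.
(* The total determinant is [det a * det h / bar (det a)]; when [bar] is trivial it is [det h], so
   the conditions defining G^0 for V and V0 agree. *)
have -> : ([&& [forall x, bar x == x], eps == 1 & true] ==>
    (\det (glmx (n * levi_nd bar a h)%g) == 1)) =
  ([&& [forall x, bar x == x], eps == 1 & true] ==> (\det (glmx h) == 1)).
  case: (boolP [forall x, bar x == x]) => [/forallP bar1 | //].
  by rewrite ep det_umx3 detcc (eqP (bar1 _)) mulrAC mulfV // mul1r.
rewrite ep mx3_1 add_mx3 !add0r det_umx3 det1cc.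
case: (_ ==> _); rewrite ?andbF ?mulr0 //= !mulf_eq0 invr_eq0 (negPf nzbd) orbF fmorph_eq0.
case: (eqVneq (\det (1%:M + glmx a)) 0) => [_|nz1] /=; first by rewrite !mul0r.
case: (eqVneq (\det (1%:M + glmx h)) 0) => [_|nz2] /=; first by rewrite mulr0.
set da := \det (1%:M + glmx a); set dh := \det (1%:M + glmx h).
have nzb : bar da != 0 by rewrite fmorph_eq0.
have [chi1 chiM] := chi_char.
have chiV : chi (bar d)^-1 = (chi (bar d))^-1.
  have nzc := is_charE_neq0 chi_char nzbd.
  by apply: (mulfI nzc); rewrite -chiM ?invr_eq0 // !mulfV.
by rewrite !chiM ?chiV ?mulf_neq0 ?invr_eq0 //; ring.
Qed.

End NondegenerateCount.

(** * Assembly of both cases from the abstract induction argument *)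

Unset Implicit Arguments.

Theorem mainTheorem6
  (E : finFieldType) (C : closedFieldType)
  (bar : {rmorphism E -> E}) (bar_invol : forall x : E, bar (bar x) = x)
  (q_odd : odd (qF bar))
  (q_unit : (qF bar)%:R != 0 :> C)
  (sq : C) (sq_def : sq ^+ 2 = (qF bar)%:R)
  (chi : E -> C) (chi_char : is_charE chi)
  (chi_1q : exists x : E, x != 0 /\ chi (x * bar x) != 1)
  (m n0 : nat)
  (dtau : nat) (tau : mx_representation C (isom_group bar (0 : 'M[E]_m)) dtau)
  (tau_irr : mx_irreducible tau) :
  let chi1q := fun x : E => chi (x * bar x) in
  let tau_chi := fun a : GLt E m => (chi (bar (\det (glmx a))))^-1 *: tau a in
  (* (1) nondegenerate form on V = X (+) V0 (+) Y *)
  (forall (eps : E) (B0 : 'M[E]_n0),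
     (eps = 1 \/ eps = -1) ->
     ((exists x : E, bar x != x) -> eps = 1) ->
     B0 \in unitmx ->
     B0^T = eps *: map_mx bar B0 ->
     forall (d0 : nat) (pi0 : mx_representation C (isom_group bar B0) d0),
     mx_irreducible pi0 ->
     forall (dpi : nat)
       (pi : mx_representation C (isom_group bar (form_full eps m B0)) dpi),
     mx_irreducible pi ->
     is_subrep (isom_set bar (form_full eps m B0)) pi
       (Ind_mx (isom_set bar (form_full eps m B0)) (parab_nd bar eps m B0)
          (boxtimes (@levi_X_nd E m n0) (@levi_V0_nd E m n0) tau pi0)) ->
     forall a b : C,
       Jmx bar sq 1 (0 : 'M[E]_m) tau_chi chi1q = a%:M ->
       Jmx bar sq eps B0 pi0 chi = b%:M ->
       Jmx bar sq eps (form_full eps m B0) pi chi = (a * b)%:M) /\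
  (* (2) zero form on V = X (+) V0 *)
  (forall (d0 : nat) (pi0 : mx_representation C (isom_group bar (0 : 'M[E]_n0)) d0),
     mx_irreducible pi0 ->
     forall (dpi : nat)
       (pi : mx_representation C (isom_group bar (0 : 'M[E]_(m + n0))) dpi),
     mx_irreducible pi ->
     is_subrep (isom_set bar (0 : 'M[E]_(m + n0))) pi
       (Ind_mx (isom_set bar (0 : 'M[E]_(m + n0))) (parab_z E m n0)
          (boxtimes (@levi_X_z E m n0) (@levi_V0_z E m n0) tau pi0)) ->
     forall a b : C,
       Jmx bar sq 1 (0 : 'M[E]_m) tau chi = a%:M ->
       Jmx bar sq 1 (0 : 'M[E]_n0) pi0 chi = b%:M ->
       Jmx bar sq 1 (0 : 'M[E]_(m + n0)) pi chi = (a * b)%:M).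
Proof.
move=> chi1q tau_chi; have [u [nzu chi_u]] := chi_1q; split.
  move=> eps B0 eps_pm _ B0_unit B0_tr d0 pi0 _ dpi pi _ sub_pi a b Ja Jb.
  have eps_sqr : eps * eps = 1 by case: eps_pm => ->; rewrite ?mulrNN mulr1.
  have bar_eps : bar eps = eps by case: eps_pm => ->; rewrite ?rmorphN rmorph1.
  have two_nz := two_neq0 q_odd.
  have sumX := Jmx_sum q_unit sq_def Ja; have sum0 := Jmx_sum q_unit sq_def Jb.
  have [k cardN] := card_unip_nd_pow m bar_invol eps_sqr bar_eps B0_tr two_nz.
  have cardL := card_lie_nd m bar_invol eps_sqr bar_eps B0_tr two_nz.
  (* Expanding [a * b] by the normalization identity leaves an equality of unnormalized sums. *)
  rewrite Jmx_jkernel -(Jmx_normalization q_unit sq_def a b cardN cardL).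
  rewrite -scale_scalar_mx; congr (_ *: _).
  (* The twist is carried by the weight on GL(X), because the induced representation involves [tau]
     and not [tau_chi]. *)
  apply: (@sum_subrep_scalar C _ _ _ (isom_group bar (form_full eps m B0))
    (parab_nd_group bar eps m B0) (isom_group bar (0 : 'M_m)) (isom_group bar B0)
    (@levi_X_nd E m n0) (@levi_V0_nd E m n0) (@levi_nd E bar m n0) _ _ _ _ _ _ _ _ _ _
    tau pi0 (jkernel bar eps (form_full eps m B0) chi) _ _
    (fun g => jkernel bar 1 (0 : 'M_m) chi1q g * (chi (bar (\det (glmx g))))^-1)
    (jkernel bar eps B0 chi)) => //.
  - exact: parab_nd_sub.
  - by move=> p _; rewrite /= isom_set0 inE.
  - exact: levi_V0_nd_in.
  - exact: levi_X_ndM.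
  - exact: levi_V0_ndM.
  - by move=> g h _ Kh; apply: levi_nd_in.
  - by move=> g h _ _; apply: levi_X_levi_nd.
  - by move=> g h _ _; apply: levi_V0_levi_nd.
  - exact: jkernelJ.
  - by move=> y Gy nPy; apply: (jkernel_cusp_nd bar_invol eps_sqr bar_eps B0_unit B0_tr chi_char nzu).
  - move=> n Nn g h _ Kh; apply: jkernel_levi_nd => //.
  by rewrite -sumX; apply: eq_bigr => g _; rewrite scalerA.
move=> d0 pi0 _ dpi pi _ sub_pi a b Ja Jb.
(* For the zero form [R = 1], so the scaling factor is [det L] alone and is taken to be
   [u * bar u]. *)
have nzN : u * bar u != 0 by rewrite mulf_neq0 ?fmorph_eq0.
have sumX := Jmx_sum q_unit sq_def Ja; have sum0 := Jmx_sum q_unit sq_def Jb.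
have [k cardM] := @card_fixed_submodule E bar m n0 [set: 'M_(m, n0)]
  (in_setT _) (fun _ _ _ _ => in_setT _) (fun _ _ _ _ => in_setT _).
rewrite -card_unip_z in cardM.
rewrite Jmx_jkernel -(Jmx_normalization q_unit sq_def a b cardM (card_lie_z bar m n0)).
rewrite -scale_scalar_mx; congr (_ *: _).
apply: (@sum_subrep_scalar C _ _ _ (isom_group bar (0 : 'M_(m + n0)))
  (parab_z_group E m n0) (isom_group bar (0 : 'M_m)) (isom_group bar (0 : 'M_n0))
  (@levi_X_z E m n0) (@levi_V0_z E m n0) (@levi_z E m n0) _ _ _ _ _ _ _ _ _ _
  tau pi0 (jkernel bar 1 (0 : 'M_(m + n0)) chi) _ _
  (jkernel bar 1 (0 : 'M_m) chi) (jkernel bar 1 (0 : 'M_n0) chi)) => //.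
- by rewrite /= isom_set0 subsetT.
- by move=> p _; rewrite /= isom_set0 inE.
- by move=> p _; rewrite /= isom_set0 inE.
- exact: levi_X_zM.
- exact: levi_V0_zM.
- by move=> g h _ _; apply: levi_z_in.
- by move=> g h _ _; apply: levi_X_levi_z.
- by move=> g h _ _; apply: levi_V0_levi_z.
- exact: jkernelJ.
- by move=> y _ nPy; apply: (jkernel_cusp_z bar chi_char nzN).
by move=> n Nn g h _ _; apply: jkernel_levi_z.
Qed.
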